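(* Let $\rho,h,D,\kappa,G,b$ be positive real constants and consider, for real $k,\omega$, the (Mindlin-Reissner) dispersion relation $A(k,\omega)=0$, i.e. $$\left(\frac{\rho h^{3}}{12}\omega^{2}-Dk^{2}\right)\left(\rho\omega^{2}-\kappa Gk^{2}\right)=b^{2}\kappa G\rho h\,\omega^{2}.$$ Put $$P=\frac{\rho h^{3}\kappa G}{12}+\rho D,\quad Q=\frac{\rho h^{3}\kappa G}{12}-\rho D,\quad R=2b\kappa G\sqrt{D\rho h}.$$ (i) For $\omega\neq0$ the relation is, in terms of $S=k^{2}/\omega^{2}$, the quadratic equation $$\kappa GD\,S^{2}-P\,S+\frac{\rho^{2}h^{3}}{12}=\frac{b^{2}\kappa G\rho h}{\omega^{2}},$$ with the two solutions $$S_{\pm}=\frac{P\pm\sqrt{Q^{2}+R^{2}/\omega^{2}}}{2\kappa GD},$$ and for small $|\omega|$ $$S_{\pm}=\pm\frac{R}{2\kappa GD}\frac{1}{|\omega|}+\frac{P}{2\kappa GD}\pm\frac{Q^{2}}{4\kappa GDR}|\omega|\mp\frac{Q^{4}}{16\kappa GDR^{3}}|\omega|^{3}+O(|\omega|^{5}).$$ (ii) $S_+>0$ for all small $\omega\ne0$, and $k^{2}=\omega^{2}S_{+}\sim R|\omega|/(2\kappa GD)\to0$ as $\omega\to0$. The branch $k^2=\omega^2S_+$ (the lower branch) is pinned at the origin $(k,\omega)=(0,0)$ with parabolic tangency and satisfies, as $k\to0$, $$\omega=\pm\left(c_{1}k^{2}+c_{2}k^{4}+c_{3}k^{6}+O(k^{8})\right),$$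 $$c_{1}=\frac{\sqrt{D}}{b\sqrt{\rho h}},\quad c_{2}=-\frac{\sqrt{D}\,(12D+\kappa Gh^{3})}{24\,\kappa G\,b^{3}h^{3/2}\sqrt{\rho}},\quad c_{3}=\frac{\sqrt{D}\,(4D+\kappa Gh^{3})(36D+\kappa Gh^{3})}{384\,\kappa^{2}G^{2}b^{5}h^{5/2}\sqrt{\rho}}.$$ (iii) $S_-<0$ for small $|\omega|\neq0$, so no real $k$ exists there on the branch $k^{2}=\omega^{2}S_{-}$ (the upper branch). A real $k$ exists on it only once $|\omega|$ reaches the threshold $$\omega_{0}=\frac{2b\sqrt{3\kappa G}}{\sqrt{\rho}\,h},\qquad \omega_0^2=\frac{12b^{2}\kappa G}{\rho h^{2}},$$ and, as $k\to0$, this branch satisfies $$\omega=\pm\left(\omega_{0}+d_{1}k^{2}+d_{2}k^{4}+O(k^{6})\right),$$ $$d_{1}=\frac{\sqrt{3}\left(D+\frac{\kappa Gh^{3}}{12}\right)}{\sqrt{\kappa G}\,b\,h^{2}\sqrt{\rho}},\quad d_{2}=-\frac{\sqrt{3}\,(144D^{2}+72D\kappa Gh^{3}+\kappa^{2}G^{2}h^{6})}{576\,(\kappa G)^{3/2}b^{3}h^{3}\sqrt{\rho}}.$$ (iv) As $|\omega|\to\infty$ the equation for $S$ becomes $\kappa GD\,S^{2}-P\,S+\rho^{2}h^{3}/12=0$ (the same as for $b=0$), with the two roots $$S_{\pm}^{\infty}=\frac{P\pm|Q|}{2\kappa GD},\qquad S_{+}^{\infty}=\frac{\rho}{\kappa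 G},\qquad S_{-}^{\infty}=\frac{\rho h^{3}}{12D},$$ yielding $$\omega\sim\pm\sqrt{\frac{\kappa G}{\rho}}\,k\quad\text{and}\quad\omega\sim\pm\sqrt{\frac{12D}{\rho h^{3}}}\,k,\qquad|\omega|,|k|\to\infty,$$ respectively. These are precisely the slopes of the uncoupled ($b=0$) straight-line branches, so all four coupled branches are asymptotically straight lines with slopes determined by the individual factors.
   Context: The relation describes a plate of thickness $h$, density $\rho$, Young's modulus $E$ and Poisson's ratio $\nu$, with shear correction coefficient $\kappa$ (typical value $5/6$), shear modulus $G=\frac{E}{2(1+\nu)}$, flexural rigidity $D=\frac{Eh^{3}}{12(1-\nu^{2})}$, and coupling parameter $b$ ($b=0$: decoupled fields). A ''branch'' is a real curve of solutions $(k,\omega)$ of $A(k,\omega)=0$, regarded as $\omega$ as a function of $k$; the relation is even in both $k$ and $\omega$ and quadratic in $\omega^2$ for given $k$, so there are four branches: two with $\omega\ge0$ and their negatives. $S_\pm^\infty$ is the limit of $S_\pm$ as $|\omega|\to\infty$, and $\omega\sim sk$ means $\omega/k\to s$.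
   Formalization: The labels S_+^∞=ρ/(κG), S_-^∞=ρh³/(12D), false for Q>0 (e.g. ρ=D=κ=G=1, h=3), and the matching of slopes to branches are stated for Q≤0, with the exchanged ones for Q≥0; Q<0 is shown for G, D given by E>0, -1<ν<1 and κ≤1. *)

(* Defs.v *)
From HB Require Import structures.
From mathcomp Require Import all_boot all_order all_algebra.
From mathcomp Require Import all_classical all_reals all_analysis.

Set Implicit Arguments.
Unset Strict Implicit.
Unset Printing Implicit Defensive.

Import Order.TTheory GRing.Theory Num.Theory.
Import numFieldNormedType.Exports.

Local Open Scope classical_set_scope.
Local Open Scope ring_scope.

(** A(k, w) = 0 is the dispersion relation; b is kept as an argument so that the
    decoupled relation is the instance b = 0. *)
Definition dispersion (R : realType) (rho h D kappa G b k w : R) : R :=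
  (rho * h ^+ 3 / 12 * w ^+ 2 - D * k ^+ 2)
    * (rho * w ^+ 2 - kappa * G * k ^+ 2)
  - b ^+ 2 * kappa * G * rho * h * w ^+ 2.

Definition coefP (R : realType) (rho h D kappa G : R) : R :=
  rho * h ^+ 3 * kappa * G / 12 + rho * D.

Definition coefQ (R : realType) (rho h D kappa G : R) : R :=
  rho * h ^+ 3 * kappa * G / 12 - rho * D.

Definition coefR (R : realType) (rho h D kappa G b : R) : R :=
  2 * b * kappa * G * Num.sqrt (D * rho * h).

(** S_+ and S_-.  They are meaningful for w != 0 only; at w = 0 the convention
    x / 0 = 0 gives them junk values. *)
Definition Splus (R : realType) (rho h D kappa G b w : R) : R :=
  (coefP rho h D kappa G
   + Num.sqrt (coefQ rho h D kappa G ^+ 2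
               + coefR rho h D kappa G b ^+ 2 / w ^+ 2))
  / (2 * kappa * G * D).

Definition Sminus (R : realType) (rho h D kappa G b w : R) : R :=
  (coefP rho h D kappa G
   - Num.sqrt (coefQ rho h D kappa G ^+ 2
               + coefR rho h D kappa G b ^+ 2 / w ^+ 2))
  / (2 * kappa * G * D).

Definition Splus_infty (R : realType) (rho h D kappa G : R) : R :=
  (coefP rho h D kappa G + `|coefQ rho h D kappa G|) / (2 * kappa * G * D).

Definition Sminus_infty (R : realType) (rho h D kappa G : R) : R :=
  (coefP rho h D kappa G - `|coefQ rho h D kappa G|) / (2 * kappa * G * D).

(** Points of the curve k^2 = w^2 S_+(w).  At w = 0 the equation is
    k^2 = 0 * S_+(0) = 0: the curve is closed up by the origin, which is also the
    limit of k^2 = w^2 S_+(w) as w tends to 0. *)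
Definition on_lower (R : realType) (rho h D kappa G b k w : R) : Prop :=
  k ^+ 2 = w ^+ 2 * Splus rho h D kappa G b w.

(** Points of the curve k^2 = w^2 S_-(w).  Here w = 0 has to be excluded, since
    the junk value of S_-(0) would add the origin, which is not on this curve. *)
Definition on_upper (R : realType) (rho h D kappa G b k w : R) : Prop :=
  w != 0 /\ k ^+ 2 = w ^+ 2 * Sminus rho h D kappa G b w.

(** The branch w = f(k) satisfies w ~ s |k|, i.e. it is asymptotic to w ~ s k as
    k tends to +oo and, the branches being even in k, to w ~ - s k as k tends to
    -oo; |w| tends to infinity at both ends. *)
Definition asymptotic_slope (R : realType) (f : R -> R) (s : R) : Prop :=
  [/\ f k / k @[k --> +oo] --> s,
      f k / k @[k --> -oo] --> - s,
      `|f k| @[k --> +oo] --> +oo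
    & `|f k| @[k --> -oo] --> +oo].

(* Main.v *)
(* With x = k^2, W = w^2, a = rho^2 h^3 / 12, c = kappa G D and B = b^2 kappa G rho h
   the relation is the conic a W^2 - (P x + B) W + c x^2 = 0, where
   P^2 - 4 a c = Q^2 >= 0.  Its two nonnegative roots in W are strictly separated for
   x >= 0, and the line 2 c x = P W, where the x-derivative vanishes, runs
   between them: hence S_+ is carried by the lower root and S_- by the upper one.
   Every expansion is obtained without Taylor's theorem: a truncated series solves
   the defining quadratic equation up to the required power, and the difference of
   the two instances of that equation is the error times a factor that does not
   vanish at the origin.  The slopes at infinity follow from
   w(k) = |k| g(1/k) with g continuous at 0. *)

Require Import Defs.
From HB Require Import structures.
From mathcomp Require Import all_boot all_order all_algebra.
From mathcomp Require Import all_classical all_reals all_analysis.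
From mathcomp Require Import ring lra.

Import Order.TTheory GRing.Theory Num.Theory.
Import numFieldNormedType.Exports.

Local Open Scope classical_set_scope.
Local Open Scope ring_scope.

(** * Roots of the conic *)

Section BiquadraticCurve.
Variables (R : realType) (a c P B : R).
Hypotheses (a_gt0 : 0 < a) (c_gt0 : 0 < c) (P_gt0 : 0 < P) (B_gt0 : 0 < B).
Hypothesis P_disc : 4 * a * c <= P ^+ 2.

Definition curve_disc (x : R) : R := (P * x + B) ^+ 2 - 4 * a * c * x ^+ 2.

Definition low_root (x : R) : R := (P * x + B - Num.sqrt (curve_disc x)) / (2 * a).

Definition up_root (x : R) : R := (P * x + B + Num.sqrt (curve_disc x)) / (2 * a).

Let a_neq0 : a != 0. Proof. exact: lt0r_neq0. Qed.
Let c_neq0 : c != 0. Proof. exact: lt0r_neq0. Qed.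

(** Expanded, the discriminant is (P^2 - 4ac) x^2 + 2PBx + B^2: two nonnegative terms and a positive
    one. *)
Lemma curve_disc_gt0 x : 0 <= x -> 0 < curve_disc x.
Proof.
move=> x0; rewrite /curve_disc.
have h1 : 0 <= P * x by rewrite mulr_ge0 // ltW.
have h2 : 0 <= P * x * B by rewrite mulr_ge0 // ltW.
have h3 : 0 <= (P ^+ 2 - 4 * a * c) * x ^+ 2.
  by rewrite mulr_ge0 ?subr_ge0 ?sqr_ge0.
have h4 : 0 < B ^+ 2 by rewrite exprn_gt0.
by rewrite sqrrD exprMn; nra.
Qed.

Lemma sqr_sqrt_disc x : 0 <= x -> Num.sqrt (curve_disc x) ^+ 2 = curve_disc x.
Proof. by move=> x0; rewrite sqr_sqrtr // ltW // curve_disc_gt0. Qed.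

Lemma sqrt_disc_gt0 x : 0 <= x -> 0 < Num.sqrt (curve_disc x).
Proof. by move=> x0; rewrite sqrtr_gt0 curve_disc_gt0. Qed.

Lemma sqrt_disc_le x : 0 <= x -> Num.sqrt (curve_disc x) <= P * x + B.
Proof.
move=> x0; have PB0 : 0 <= P * x + B by rewrite addr_ge0 ?mulr_ge0 // ltW.
rewrite -(ler_pXn2r (_ : 0 < 2)%N) ?nnegrE ?sqrtr_ge0 // sqr_sqrt_disc //.
by rewrite /curve_disc gerBl !mulr_ge0 ?sqr_ge0 // ltW.
Qed.

Lemma low_root_ge0 x : 0 <= x -> 0 <= low_root x.
Proof.
by move=> x0; rewrite divr_ge0 ?subr_ge0 ?sqrt_disc_le // mulr_ge0 // ltW.
Qed.

Lemma low_root_lt_up_root x : 0 <= x -> low_root x < up_root x.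
Proof.
move=> x0; rewrite ltr_pM2r ?invr_gt0 ?mulr_gt0 //.
by have := sqrt_disc_gt0 _ x0; lra.
Qed.

Lemma up_root_gt0 x : 0 <= x -> 0 < up_root x.
Proof. by move=> x0; rewrite (le_lt_trans (low_root_ge0 _ x0)) ?low_root_lt_up_root. Qed.

Lemma low_root0 : low_root 0 = 0.
Proof.
rewrite /low_root /curve_disc mulr0 add0r expr0n /= mulr0 subr0 sqrtr_sqr.
by rewrite ger0_norm ?subrr ?mul0r // ltW.
Qed.

Lemma curve_factor x W : 0 <= x ->
  a * W ^+ 2 - (P * x + B) * W + c * x ^+ 2 = a * (W - low_root x) * (W - up_root x).
Proof.
move=> x0; have : (P * x + B) ^+ 2 - Num.sqrt (curve_disc x) ^+ 2 = 4 * a * c * x ^+ 2.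
  by rewrite sqr_sqrt_disc // /curve_disc; ring.
rewrite /low_root /up_root; set s := Num.sqrt _ => E.
(* Trading [c * x ^+ 2] for the square of [s] leaves a rational identity in [s], within reach of
   [field]. *)
have -> : c * x ^+ 2 = ((P * x + B) ^+ 2 - s ^+ 2) / (4 * a) by rewrite E; field.
by field.
Qed.

Lemma curveP x W : 0 <= x ->
  a * W ^+ 2 - (P * x + B) * W + c * x ^+ 2 = 0 <-> W = low_root x \/ W = up_root x.
Proof.
move=> x0; rewrite curve_factor //; split=> [/eqP|[->|->]].
- rewrite !mulf_eq0 (negbTE a_neq0) /= !subr_eq0 => /orP[] /eqP; by [left|right].
- by rewrite subrr mulr0 mul0r.
- by rewrite subrr mulr0.
Qed.

(* The vertex W = 2 c x / P of the curve, seen as a quadratic in x, separates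
   the two roots in W because the quadratic in W is negative there. *)
Lemma low_root_vertex x : 0 < x -> P * low_root x < 2 * c * x.
Proof.
move=> x0; rewrite mulrC -ltr_pdivlMr //.
set V := _ / P; rewrite ltNge; apply/negP => VW.
have : 0 <= a * (V - low_root x) * (V - up_root x).
  rewrite -mulrA mulr_ge0 ?(ltW a_gt0) // mulr_le0 ?subr_le0 //.
  by rewrite (le_trans VW) // ltW // low_root_lt_up_root // ltW.
rewrite -curve_factor; last exact: ltW.
have -> : a * V ^+ 2 - (P * x + B) * V + c * x ^+ 2 =
    - (c * x ^+ 2 * (P ^+ 2 - 4 * a * c) / P ^+ 2 + 2 * c * B * x / P).
  by rewrite /V; field; exact: lt0r_neq0.
rewrite oppr_ge0 leNgt ltr_wpDl //.
  by rewrite divr_ge0 ?sqr_ge0 // !mulr_ge0 ?sqr_ge0 ?subr_ge0 // ltW.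
by rewrite divr_gt0 // !mulr_gt0.
Qed.

(** Mirror image of the previous argument. The case x = 0 is included, since the upper root is
    positive there, whereas for the lower root both sides vanish. *)
Lemma up_root_vertex x : 0 <= x -> 2 * c * x < P * up_root x.
Proof.
move=> x0; rewrite mulrC [X in _ < X]mulrC -ltr_pdivrMr //.
set V := _ / P; rewrite ltNge; apply/negP => VW.
have : 0 <= a * (V - low_root x) * (V - up_root x).
  rewrite !mulr_ge0 ?(ltW a_gt0) ?subr_ge0 //.
  by rewrite (le_trans _ VW) // ltW // low_root_lt_up_root.
rewrite -curve_factor //.
have -> : a * V ^+ 2 - (P * x + B) * V + c * x ^+ 2 =
    - (c * x ^+ 2 * (P ^+ 2 - 4 * a * c) / P ^+ 2 + 2 * c * B * x / P).
  by rewrite /V; field; exact: lt0r_neq0.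
(* Under the contrary assumption V dominates a positive root, so x cannot be 0 and the term 2cBx/P
   below is strictly positive. *)
have : 0 < V by rewrite (lt_le_trans _ VW) ?up_root_gt0.
rewrite /V pmulr_lgt0 ?invr_gt0 // pmulr_lgt0 ?mulr_gt0 // => x_gt0.
rewrite oppr_ge0 leNgt ltr_wpDl //.
  by rewrite divr_ge0 ?sqr_ge0 // !mulr_ge0 ?sqr_ge0 ?subr_ge0 // ltW.
by rewrite divr_gt0 // !mulr_gt0.
Qed.

Lemma eq_sqrtP (t d : R) : 0 <= d -> t = Num.sqrt d <-> 0 <= t /\ t ^+ 2 = d.
Proof.
move=> d0; split=> [->|[t0 <-]]; last by rewrite sqrtr_sqr ger0_norm.
by rewrite sqrtr_ge0 sqr_sqrtr.
Qed.

Let slow_disc_ge0 W : 0 < W -> 0 <= P ^+ 2 - 4 * a * c + 4 * c * B / W.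
Proof.
by move=> W0; rewrite addr_ge0 ?subr_ge0 // !mulr_ge0 ?invr_ge0 // ltW.
Qed.

(** Completing the square in x: the two sides of the first equation differ by the conic times
    4c/W^2, which is nonzero. *)
Let slowness_disc x W : 0 < W ->
  (2 * c * x / W - P) ^+ 2 = P ^+ 2 - 4 * a * c + 4 * c * B / W <->
  a * W ^+ 2 - (P * x + B) * W + c * x ^+ 2 = 0.
Proof.
move=> W0; have W_neq0 : W != 0 by exact: lt0r_neq0.
have E : (2 * c * x / W - P) ^+ 2 - (P ^+ 2 - 4 * a * c + 4 * c * B / W) =
    4 * c / W ^+ 2 * (a * W ^+ 2 - (P * x + B) * W + c * x ^+ 2) by field.
split=> [/eqP|H].
  rewrite -subr_eq0 E mulf_eq0 => /orP[/eqP H|/eqP //].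
  suff : 4 * c / W ^+ 2 != 0 by rewrite H eqxx.
  by rewrite lt0r_neq0 // divr_gt0 ?exprn_gt0 // mulr_gt0.
by apply/eqP; rewrite -subr_eq0 E H mulr0.
Qed.

(** A nonnegative square root means [P * W <= 2 * c * x], and the vertex inequalities leave only the
    lower root on that side. At x = 0 the lower root is 0, which W > 0 excludes. *)
Lemma slowness_low_root x W : 0 <= x -> 0 < W ->
  x = W * ((P + Num.sqrt (P ^+ 2 - 4 * a * c + 4 * c * B / W)) / (2 * c)) <->
  W = low_root x.
Proof.
move=> x0 W0; have W_neq0 : W != 0 by exact: lt0r_neq0.
transitivity (2 * c * x / W - P = Num.sqrt (P ^+ 2 - 4 * a * c + 4 * c * B / W)).
  split=> [->|<-]; by field; rewrite ?W_neq0 ?c_neq0.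
rewrite eq_sqrtP ?slow_disc_ge0 // slowness_disc // curveP // subr_ge0 ler_pdivlMr //.
split=> [[H [//|E]]|E].
  by have := up_root_vertex _ x0; rewrite -E ltNge H.
split; [rewrite {1}E|by left]; apply/ltW/low_root_vertex.
by rewrite lt_neqAle x0 andbT; apply/eqP => x0'; move: W0; rewrite E -x0' low_root0 ltxx.
Qed.

Lemma slowness_up_root x W : 0 <= x -> 0 < W ->
  x = W * ((P - Num.sqrt (P ^+ 2 - 4 * a * c + 4 * c * B / W)) / (2 * c)) <->
  W = up_root x.
Proof.
move=> x0 W0; have W_neq0 : W != 0 by exact: lt0r_neq0.
transitivity (P - 2 * c * x / W = Num.sqrt (P ^+ 2 - 4 * a * c + 4 * c * B / W)).
  split=> [->|<-]; by field; rewrite ?W_neq0 ?c_neq0.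
rewrite eq_sqrtP ?slow_disc_ge0 // -sqrrN opprB slowness_disc // curveP //.
rewrite subr_ge0 ler_pdivrMr //.
split=> [[H [E|//]]|E].
  (* The strict vertex inequality for the lower root rules it out for x > 0; at x = 0 it would give
     W = 0. *)
  have [x_gt0|x_le0] := ltP 0 x.
    by have := low_root_vertex _ x_gt0; rewrite -E ltNge H.
  by move: W0; rewrite E (_ : x = 0) ?low_root0 ?ltxx //; apply/le_anti/andP.
by split; [rewrite {1}E; apply/ltW/up_root_vertex|right].
Qed.

End BiquadraticCurve.

(** * Big-O and asymptotic slopes *)

Section Asymptotics.
Variable R : realType.
Implicit Types (f g h : R -> R).

(** Common tool for the expansions: [E] contains the conjugate sum that turns the difference [f - g]
    into a polynomial expression, and has a nonzero limit, while the cofactor [p] stays bounded. *)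
Lemma eqaddO_factor (F : filter_on R) (E p f g h : R -> R) (e q : R) :
  E x @[x --> F] --> e -> e != 0 -> p x @[x --> F] --> q ->
  (\forall x \near F, E x * (f x - g x) = h x * p x) -> f = g +O_ F h.
Proof.
move=> Ee e0 pq H; apply/eqaddOP/bigO_exP.
have e_gt0 : 0 < `|e| by rewrite normr_gt0.
(* Eventually |p| < |q| + 1 and |E| > |e|/2, which gives this constant. *)
exists ((`|q| + 1) * (2 / `|e|)); first by rewrite mulr_gt0 ?divr_gt0 ?ltr_wpDl.
have HE : \forall x \near F, `|e| / 2 < `|E x|.
  by apply: cvgr_norm_gt Ee _ _; rewrite ltr_pdivrMr // ltr_pMr // ltr1n.
have Hp : \forall x \near F, `|p x| < `|q| + 1.
  by apply: cvgr_norm_lt pq _ _; rewrite ltrDl.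
near=> x; rewrite mulrAC mulrA ler_pdivlMr // -ler_pdivrMr // -mulrA.
apply: (@le_trans _ _ (`|f x - g x| * `|E x|)).
  by rewrite ler_wpM2l //; apply/ltW; near: x.
rewrite mulrC -normrM (near H x) // normrM mulrC.
by rewrite ler_wpM2r //; apply/ltW; near: x.
Unshelve. all: by end_near. Qed.

Lemma equiv_factor (F : filter_on R) (th f g : R -> R) :
  th x @[x --> F] --> (1 : R) -> (\forall x \near F, f x = g x * th x) -> f ~_F g.
Proof.
move=> th1 H; apply/eqaddoP => e e0.
have He : \forall x \near F, `|1 - th x| < e by exact: cvgr_dist_lt th1 _ e0.
near=> x; rewrite /= !fctE (near H x) // -[X in _ - X]mulr1 -mulrBr normrM mulrC.
by rewrite ler_wpM2r // distrC; apply/ltW; near: x.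
Unshelve. all: by end_near. Qed.

Lemma cvg_inv_pinfty : x^-1 @[x --> +oo] --> (0 : R).
Proof. by apply/gtr0_cvgV0; [exact: nbhs_pinfty_gt|exact: cvg_id]. Qed.

Lemma cvg_inv_ninfty : x^-1 @[x --> -oo] --> (0 : R).
Proof. by apply/ltr0_cvgV0; [exact: nbhs_ninfty_lt|exact: cvg_id]. Qed.

Lemma asymptotic_slopeN f s : asymptotic_slope f s -> asymptotic_slope (- f) (- s).
Proof.
case=> fp fn np nn; split.
- under eq_fun do rewrite /= mulNr; exact: cvgN.
- under eq_fun do rewrite /= mulNr; exact: cvgN.
- by under eq_fun do rewrite /= normrN.
- by under eq_fun do rewrite /= normrN.
Qed.

(** The substitution y = 1/k sends both ends to 0, and the factor |k| produces opposite slopes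
    there. Since s is nonzero, |f k| eventually exceeds |k| |s|/2 and diverges. *)
Lemma asymptotic_slope_norm f g s : s != 0 -> g y @[y --> 0] --> s ->
  (forall k, k != 0 -> f k = `|k| * g k^-1) -> asymptotic_slope f s.
Proof.
move=> s0 gs fg.
have gp : g k^-1 @[k --> +oo] --> s by apply: cvg_comp gs; exact: cvg_inv_pinfty.
have gn : g k^-1 @[k --> -oo] --> s by apply: cvg_comp gs; exact: cvg_inv_ninfty.
have s2 : 0 < `|s| / 2 by rewrite divr_gt0 ?normr_gt0.
have s2s : `|s| / 2 < `|s|.
  by rewrite ltr_pdivrMr // ltr_pMr ?normr_gt0 // ltr1n.
split.
- apply: cvg_trans gp; apply: near_eq_cvg; near=> k.
  have k0 : 0 < k by near: k; exact: nbhs_pinfty_gt.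
  by rewrite fg ?gt_eqF // gtr0_norm // mulrC mulKf ?gt_eqF.
- apply: cvg_trans (cvgN gn); apply: near_eq_cvg; near=> k.
  have k0 : k < 0 by near: k; exact: nbhs_ninfty_lt.
  by rewrite fg ?lt_eqF // ltr0_norm //= mulrC mulNr mulrN mulKf ?lt_eqF.
- apply: (@ger_cvgy _ _ _ _ (fun k => k * (`|s| / 2))).
    near=> k; have k0 : 0 < k by near: k; exact: nbhs_pinfty_gt.
    rewrite fg ?gt_eqF // normrM normr_id (gtr0_norm k0) ler_wpM2l ?(ltW k0) //.
    by apply/ltW; near: k; exact: cvgr_norm_gt gp _ s2s.
  by apply: gt0_cvgMly => //; exact: cvg_id.
- apply: (@ger_cvgy _ _ _ _ (fun k => (- k) * (`|s| / 2))).
    near=> k; have k0 : k < 0 by near: k; exact: nbhs_ninfty_lt.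
    rewrite fg ?lt_eqF // normrM normr_id (ltr0_norm k0) ler_wpM2l ?oppr_ge0 ?(ltW k0) //.
    by apply/ltW; near: k; exact: cvgr_norm_gt gn _ s2s.
  by apply: gt0_cvgMly => //; apply/cvgNry; exact: cvg_id.
Unshelve. all: by end_near. Qed.

End Asymptotics.

Lemma cvg_exprn (R : realType) (T : Type) (F : set_system T) (FF : Filter F)
    (f : T -> R) (l : R) (n : nat) :
  f x @[x --> F] --> l -> f x ^+ n @[x --> F] --> l ^+ n.
Proof. by move=> fl; apply: (cvg_comp _ (fun y : R => y ^+ n) fl); exact: exprn_continuous. Qed.

Lemma cvg_sqrtr (R : realType) (T : Type) (F : set_system T) (FF : Filter F)
    (f : T -> R) (l : R) :
  f x @[x --> F] --> l -> Num.sqrt (f x) @[x --> F] --> Num.sqrt l.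
Proof. by move=> fl; apply: (cvg_comp _ (@Num.sqrt R) fl); exact: sqrt_continuous. Qed.

(* The limit has to be written as the same expression, with each leaf replaced
   by its limit; limits of leaves are looked up among the hypotheses. *)
Ltac solve_cvg :=
  cbv beta;
  lazymatch goal with
  | |- cvg_to (nbhs (fmap (fun _ => ?y) _)) _ => exact: cvg_cst
  | |- cvg_to (nbhs (fmap (fun x => x) _)) _ => exact: cvg_id
  | |- cvg_to (nbhs (fmap (fun x => @?f x + @?g x) _)) _ =>
      apply: cvgD; solve_cvg
  | |- cvg_to (nbhs (fmap (fun x => - (@?f x)) _)) _ =>
      apply: cvgN; solve_cvg
  | |- cvg_to (nbhs (fmap (fun x => @?f x * @?g x) _)) _ =>
      apply: cvgM; solve_cvg
  | |- cvg_to (nbhs (fmap (fun x => (@?f x) ^+ ?n) _)) _ =>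
      apply: cvg_exprn; solve_cvg
  | |- cvg_to (nbhs (fmap (fun x => Num.sqrt (@?f x)) _)) _ =>
      apply: cvg_sqrtr; solve_cvg
  | |- _ => assumption
  end.

(** * Slownesses near zero and at infinity *)

Section Expansions.
Variable R : realType.
Implicit Types (k w : R).

Lemma cvg_abs0 : `|w| @[w --> (0 : R)^'] --> (0 : R).
Proof.
rewrite -[X in _ --> X](@normr0 _ R); apply: cvg_norm.
by apply: cvg_within_filter; exact: cvg_id.
Qed.

(** The singularity at w = 0 is moved out of the radical; what remains under the root is continuous
    in |w| at 0. *)
Lemma slowness_scaled (P Q r c eps w : R) : c != 0 -> w != 0 ->
  (P + eps * Num.sqrt (Q ^+ 2 + r ^+ 2 / w ^+ 2)) / (2 * c) =
  (P + eps * (Num.sqrt (r ^+ 2 + Q ^+ 2 * `|w| ^+ 2) / `|w|)) / (2 * c).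
Proof.
move=> c0 w0; have w1 : `|w| != 0 by rewrite normr_eq0.
congr ((P + eps * _) / _); rewrite real_normK ?num_real //.
have -> : Q ^+ 2 + r ^+ 2 / w ^+ 2 = (r ^+ 2 + Q ^+ 2 * w ^+ 2) / `|w| ^+ 2.
  by rewrite real_normK ?num_real //; field.
rewrite sqrtrM; last by rewrite addr_ge0 ?sqr_ge0 // mulr_ge0 ?sqr_ge0.
by rewrite sqrtrV ?sqr_ge0 // sqrtr_sqr normr_id.
Qed.

(** The series added to [y] is the binomial expansion of r sqrt(1 + (Qt/r)^2) up to t^4. Its square
    differs from y^2 only from t^6 on, and the division by t costs one power. *)
Lemma slowness_expansion_identity (P Q r c eps t y : R) :
  r != 0 -> c != 0 -> t != 0 -> y ^+ 2 = r ^+ 2 + Q ^+ 2 * t ^+ 2 ->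
  (y + (r + Q ^+ 2 / (2 * r) * t ^+ 2 - Q ^+ 4 / (8 * r ^+ 3) * t ^+ 4)) * (2 * c)
  * ((P + eps * (y / t)) / (2 * c)
     - (eps * (r / (2 * c) * t^-1) + P / (2 * c) + eps * (Q ^+ 2 / (4 * c * r) * t)
        - eps * (Q ^+ 4 / (16 * c * r ^+ 3) * t ^+ 3)))
  = t ^+ 5 * (eps * (Q ^+ 6 / (8 * r ^+ 4) - Q ^+ 8 / (64 * r ^+ 6) * t ^+ 2)).
Proof.
move=> r0 c0 t0 y2.
transitivity (eps * ((y ^+ 2
  - (r + Q ^+ 2 / (2 * r) * t ^+ 2 - Q ^+ 4 / (8 * r ^+ 3) * t ^+ 4) ^+ 2) / t)).
  by field; rewrite r0 c0 t0.
by rewrite y2; field; rewrite r0 t0.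
Qed.

(* Squaring the truncated series of y = sqrt (r^2 + Q^2 t^2) makes y - series a
   multiple of t^6 up to the non-vanishing factor y + series. *)
Lemma slowness_expansion (P Q r c eps : R) : 0 < r -> c != 0 ->
  (fun w => (P + eps * Num.sqrt (Q ^+ 2 + r ^+ 2 / w ^+ 2)) / (2 * c)) =
  (fun w => eps * (r / (2 * c) * `|w|^-1) + P / (2 * c)
            + eps * (Q ^+ 2 / (4 * c * r) * `|w|)
            - eps * (Q ^+ 4 / (16 * c * r ^+ 3) * `|w| ^+ 3))
  +O_ (0^') (fun w => `|w| ^+ 5).
Proof.
move=> r0 c0; have r_neq0 : r != 0 by exact: lt0r_neq0.
pose y t := Num.sqrt (r ^+ 2 + Q ^+ 2 * t ^+ 2).
pose al t := r + Q ^+ 2 / (2 * r) * t ^+ 2 - Q ^+ 4 / (8 * r ^+ 3) * t ^+ 4.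
pose E w := (y `|w| + al `|w|) * (2 * c).
pose p w := eps * (Q ^+ 6 / (8 * r ^+ 4) - Q ^+ 8 / (64 * r ^+ 6) * `|w| ^+ 2).
have t0 := cvg_abs0.
have Ecvg : E w @[w --> 0^'] --> (y 0 + al 0) * (2 * c).
  by rewrite /E /y /al; solve_cvg.
have pcvg : p w @[w --> 0^'] -->
    eps * (Q ^+ 6 / (8 * r ^+ 4) - Q ^+ 8 / (64 * r ^+ 6) * 0 ^+ 2).
  by rewrite /p; solve_cvg.
apply: (eqaddO_factor _ _ _ _ _ _ _ _ _ Ecvg _ pcvg).
- rewrite /y /al !expr0n /= !mulr0 !addr0 subr0 sqrtr_sqr gtr0_norm //.
  by rewrite !mulf_neq0 // lt0r_neq0 // addr_gt0.
- near=> w; have w0 : w != 0 by near: w; exact: nbhs_dnbhs_neq.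
have w1 : `|w| != 0 by rewrite normr_eq0.
rewrite slowness_scaled // /E -/(y `|w|); set t := `|w| in w1 *.
have y2 : y t ^+ 2 = r ^+ 2 + Q ^+ 2 * t ^+ 2.
  by rewrite sqr_sqrtr // addr_ge0 ?sqr_ge0 // mulr_ge0 ?sqr_ge0.
exact: slowness_expansion_identity.
Unshelve. all: by end_near. Qed.

Lemma slowness_sqr_equiv (P Q r c : R) : 0 < r -> c != 0 ->
  (fun w => w ^+ 2 * ((P + Num.sqrt (Q ^+ 2 + r ^+ 2 / w ^+ 2)) / (2 * c)))
  ~_ (0^') (fun w => r * `|w| / (2 * c)).
Proof.
move=> r0 c0; have r_neq0 : r != 0 by exact: lt0r_neq0.
have t0 := cvg_abs0.
(* This is the quotient of the two sides for w nonzero; it tends to sqrt(r^2)/r = 1. *)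
have th1 : (P * `|w| + Num.sqrt (r ^+ 2 + Q ^+ 2 * `|w| ^+ 2)) * r^-1
    @[w --> (0 : R)^'] --> (1 : R).
  have -> : 1 = (P * 0 + Num.sqrt (r ^+ 2 + Q ^+ 2 * 0 ^+ 2)) * r^-1.
    by rewrite expr0n /= !mulr0 addr0 add0r sqrtr_sqr gtr0_norm // divff.
  by solve_cvg.
apply: (equiv_factor _ _ _ _ _ th1).
near=> w; have w0 : w != 0 by near: w; exact: nbhs_dnbhs_neq.
have w1 : `|w| != 0 by rewrite normr_eq0.
have := slowness_scaled P Q r c 1 w c0 w0; rewrite !mul1r => ->.
rewrite -[w ^+ 2]real_normK ?num_real //.
by field; rewrite ?w1 ?r_neq0 ?c0.
Unshelve. all: by end_near. Qed.

Lemma slowness_cvg_pinfty (P Q r c eps : R) :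
  (P + eps * Num.sqrt (Q ^+ 2 + r ^+ 2 / w ^+ 2)) / (2 * c) @[w --> +oo] -->
  (P + eps * `|Q|) / (2 * c).
Proof.
have i0 := @cvg_inv_pinfty R.
have H : (P + eps * Num.sqrt (Q ^+ 2 + r ^+ 2 * w^-1 ^+ 2)) / (2 * c) @[w --> +oo] -->
    (P + eps * Num.sqrt (Q ^+ 2 + r ^+ 2 * 0 ^+ 2)) / (2 * c) by solve_cvg.
rewrite expr0n /= mulr0 addr0 sqrtr_sqr in H; apply: cvg_trans H.
by apply: near_eq_cvg; apply: nearW => w; rewrite exprVn.
Qed.

Lemma slowness_cvg_ninfty (P Q r c eps : R) :
  (P + eps * Num.sqrt (Q ^+ 2 + r ^+ 2 / w ^+ 2)) / (2 * c) @[w --> -oo] -->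
  (P + eps * `|Q|) / (2 * c).
Proof.
apply/cvgNy_compNP; apply: cvg_trans (slowness_cvg_pinfty P Q r c eps).
by apply: near_eq_cvg; apply: nearW => w; rewrite /= sqrrN.
Qed.

End Expansions.

(** * Expansions of the branches *)

Section BranchExpansions.
Variables (R : realType) (a c P B : R).
Hypotheses (a_gt0 : 0 < a) (c_gt0 : 0 < c) (P_gt0 : 0 < P) (B_gt0 : 0 < B).
Hypothesis P_disc : 4 * a * c <= P ^+ 2.

Local Notation disc := (curve_disc R a c P B).

Definition low_branch (k : R) : R := Num.sqrt (low_root R a c P B (k ^+ 2)).
Definition up_branch (k : R) : R := Num.sqrt (up_root R a c P B (k ^+ 2)).

Let a_neq0 : a != 0. Proof. exact: lt0r_neq0. Qed.
Let B_neq0 : B != 0. Proof. exact: lt0r_neq0. Qed.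

Lemma low_branch_sqr k : low_branch k ^+ 2 = low_root R a c P B (k ^+ 2).
Proof. by rewrite sqr_sqrtr // low_root_ge0 // sqr_ge0. Qed.

Lemma up_branch_sqr k : up_branch k ^+ 2 = up_root R a c P B (k ^+ 2).
Proof. by rewrite sqr_sqrtr // ltW // up_root_gt0 // sqr_ge0. Qed.

Lemma low_branch_ge0 k : 0 <= low_branch k.
Proof. exact: sqrtr_ge0. Qed.

Lemma low_branch_lt_up_branch k : low_branch k < up_branch k.
Proof.
rewrite ltr_sqrt ?low_root_lt_up_root ?sqr_ge0 //.
by rewrite up_root_gt0 ?sqr_ge0.
Qed.

Lemma low_branch_continuous : continuous low_branch.
Proof. by rewrite /low_branch /low_root /curve_disc => k; rewrite /continuous_at; solve_cvg. Qed.

Lemma up_branch_continuous : continuous up_branch.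
Proof. by rewrite /up_branch /up_root /curve_disc => k; rewrite /continuous_at; solve_cvg. Qed.

Lemma up_branch_curve k :
  a * (up_branch k ^+ 2) ^+ 2 - (P * k ^+ 2 + B) * up_branch k ^+ 2
  + c * (k ^+ 2) ^+ 2 = 0.
Proof. by apply/curveP; rewrite ?sqr_ge0 // up_branch_sqr; right. Qed.

(* low_branch k = k^2 * low_curvature k, without the cancellation at k = 0 *)
Definition low_curvature (k : R) : R :=
  Num.sqrt (2 * c / (P * k ^+ 2 + B + Num.sqrt (disc (k ^+ 2)))).

Let low_den_gt0 k : 0 < P * k ^+ 2 + B + Num.sqrt (disc (k ^+ 2)).
Proof.
by rewrite addr_gt0 ?sqrt_disc_gt0 ?sqr_ge0 // ltr_wpDl // mulr_ge0 ?sqr_ge0 // ltW.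
Qed.

Lemma low_curvature_sqr k :
  low_curvature k ^+ 2 = 2 * c / (P * k ^+ 2 + B + Num.sqrt (disc (k ^+ 2))).
Proof.
by rewrite sqr_sqrtr // divr_ge0 ?(ltW (low_den_gt0 k)) // mulr_ge0 // ltW.
Qed.

(** Rationalisation: with s the root of the discriminant, (P k^2 + B)^2 - s^2 = 4ac k^4, so the
    difference in [low_root] becomes k^4 over a positive sum. *)
Lemma low_branchE k : low_branch k = k ^+ 2 * low_curvature k.
Proof.
rewrite -[k ^+ 2 in RHS]ger0_norm ?sqr_ge0 // -sqrtr_sqr -sqrtrM ?sqr_ge0 //.
congr Num.sqrt; rewrite /low_root.
have := sqr_sqrt_disc R a c P B P_gt0 B_gt0 P_disc (k ^+ 2) (sqr_ge0 k).
have := lt0r_neq0 (low_den_gt0 k); set s := Num.sqrt _; rewrite /curve_disc => n0 s2.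
have E : (k ^+ 2) ^+ 2 * (2 * c) = ((P * k ^+ 2 + B) ^+ 2 - s ^+ 2) / (2 * a).
  by rewrite s2; field.
by rewrite [RHS]mulrA E; field; rewrite n0.
Qed.

(** This is the conic for [low_branch] divided by k^4. It is derived from the closed form, so that
    it also holds at k = 0. *)
Lemma low_curvature_curve k :
  a * (k ^+ 2) ^+ 2 * (low_curvature k ^+ 2) ^+ 2
  - (P * k ^+ 2 + B) * low_curvature k ^+ 2 + c = 0.
Proof.
have := sqr_sqrt_disc R a c P B P_gt0 B_gt0 P_disc (k ^+ 2) (sqr_ge0 k).
have := lt0r_neq0 (low_den_gt0 k).
rewrite low_curvature_sqr; set s := Num.sqrt _; rewrite /curve_disc => n0 s2.
have ak : a * (k ^+ 2) ^+ 2 = ((P * k ^+ 2 + B) ^+ 2 - s ^+ 2) / (4 * c).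
  by rewrite s2; field; exact: lt0r_neq0.
by rewrite ak; field; rewrite n0 lt0r_neq0.
Qed.

Lemma low_curvature_continuous : continuous low_curvature.
Proof.
rewrite /low_curvature /curve_disc => k; rewrite /continuous_at.
apply: cvg_sqrtr.
apply: cvgM; first exact: cvg_cst.
by apply: cvgV; [exact: lt0r_neq0 (low_den_gt0 k)|solve_cvg].
Qed.

Lemma low_curvature0 : low_curvature 0 ^+ 2 = c / B.
Proof.
rewrite low_curvature_sqr /curve_disc !expr0n /= !mulr0 add0r subr0 sqrtr_sqr.
by rewrite gtr0_norm // -mulr2n -[B *+ 2]mulr_natl; field.
Qed.

(* The truncation al solves the equation of the curve up to k^6; the difference
   of the two instances of the equation factors through up_branch - al. *)
Lemma up_branch_expansion (w0 d1 d2 : R) : 0 < w0 ->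
  a * w0 ^+ 2 = B -> 2 * a * w0 * d1 = P -> B * (d1 ^+ 2 + 2 * w0 * d2) = - c ->
  up_branch = (fun k => w0 + d1 * k ^+ 2 + d2 * k ^+ 4) +O_ (nbhs 0) (fun k => k ^+ 6).
Proof.
move=> w0_gt0 hB hP hc; have uc := up_branch_continuous 0.
pose al x := w0 + d1 * x + d2 * x ^+ 2.
(* [e] is the coefficient of x^2 in the square of [al], so the third hypothesis reads B e = -c. *)
pose e := d1 ^+ 2 + 2 * w0 * d2.
pose E k := (up_branch k + al (k ^+ 2))
  * (a * (up_branch k ^+ 2 + al (k ^+ 2) ^+ 2) - (P * k ^+ 2 + B)).
pose p x := - (al x ^+ 2 * (2 * a * d1 * d2 + a * d2 ^+ 2 * x)
  + a * e * (2 * w0 * d1 + e * x + 2 * d1 * d2 * x ^+ 2 + d2 ^+ 2 * x ^+ 3)).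
have u0 : up_branch 0 = w0.
  rewrite /up_branch /up_root /curve_disc !expr0n /= !mulr0 add0r subr0 sqrtr_sqr.
  rewrite gtr0_norm // (_ : _ / _ = w0 ^+ 2) ?sqrtr_sqr ?gtr0_norm //.
  by rewrite -hB; field.
have Ecvg : E k @[k --> (0 : R)] --> E 0 by rewrite /E /al; solve_cvg.
have pcvg : p (k ^+ 2) @[k --> (0 : R)] --> p (0 ^+ 2).
  by rewrite /p /al; solve_cvg.
apply: (eqaddO_factor _ _ _ _ _ _ _ _ _ Ecvg _ pcvg).
(* At 0 the factor is 2 w0 (2 a w0^2 - B) = 2 w0 B, which is nonzero. *)
- rewrite /E u0 /al !expr0n /= !mulr0 !addr0 add0r mulf_neq0 //.
    by rewrite lt0r_neq0 ?addr_gt0.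
  by rewrite (_ : _ - _ = B) // -hB; ring.
- near=> k; set u := up_branch k.
have hu : a * (u ^+ 2) ^+ 2 - (P * k ^+ 2 + B) * u ^+ 2 + c * (k ^+ 2) ^+ 2 = 0.
  exact: up_branch_curve.
transitivity (- (a * (al (k ^+ 2) ^+ 2) ^+ 2 - (P * k ^+ 2 + B) * al (k ^+ 2) ^+ 2
                 + c * (k ^+ 2) ^+ 2)).
  by rewrite -[RHS]add0r -hu /E -/u /al; ring.
by rewrite -[c]opprK -hc -hP -hB /p /e /al; ring.
Unshelve. all: by end_near. Qed.

(** The series is computed for [low_curvature], whose value c1 at 0 is nonzero; for [low_branch]
    itself the conjugate sum would vanish at 0. The last three hypotheses cancel the coefficients of
    1, k^2 and k^4 in the equation of the curve, and the factor k^2 lifts the error from k^6 to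
    k^8. *)
Lemma low_branch_expansion (c1 c2 c3 : R) : 0 < c1 ->
  B * c1 ^+ 2 = c -> P * c1 + 2 * B * c2 = 0 ->
  a * c1 ^+ 4 - 2 * P * c1 * c2 - B * (c2 ^+ 2 + 2 * c1 * c3) = 0 ->
  low_branch = (fun k => c1 * k ^+ 2 + c2 * k ^+ 4 + c3 * k ^+ 6)
    +O_ (nbhs 0) (fun k => k ^+ 8).
Proof.
move=> c1_gt0 h1 h2 h3; have vc := low_curvature_continuous 0.
pose al x := c1 + c2 * x + c3 * x ^+ 2.
pose E k := (low_curvature k + al (k ^+ 2))
  * (a * (k ^+ 2) ^+ 2 * (low_curvature k ^+ 2 + al (k ^+ 2) ^+ 2) - (P * k ^+ 2 + B)).
(* [r x] is (al^2 - c1^2)/x as a polynomial, so al^4 - c1^4 = x r (al^2 + c1^2) in the remainder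
   [p]. *)
pose r x := 2 * c1 * c2 + (c2 ^+ 2 + 2 * c1 * c3) * x + 2 * c2 * c3 * x ^+ 2
  + c3 ^+ 2 * x ^+ 3.
pose p x := - (a * r x * (al x ^+ 2 + c1 ^+ 2)
  - P * (c2 ^+ 2 + 2 * c1 * c3 + 2 * c2 * c3 * x + c3 ^+ 2 * x ^+ 2)
  - B * (2 * c2 * c3 + c3 ^+ 2 * x)).
have v0 : low_curvature 0 = c1.
  apply/eqP; rewrite -(@eqrXn2 _ 2) ?sqrtr_ge0 ?(ltW c1_gt0) //.
  by rewrite low_curvature0 -h1 mulrAC divff ?mul1r.
have Ecvg : E k @[k --> (0 : R)] --> E 0 by rewrite /E /al; solve_cvg.
have pcvg : p (k ^+ 2) @[k --> (0 : R)] --> p (0 ^+ 2).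
  by rewrite /p /r /al; solve_cvg.
apply: (eqaddO_factor _ _ _ _ _ _ _ _ _ Ecvg _ pcvg).
- rewrite /E v0 /al !expr0n /= !mulr0 !addr0 mul0r !add0r mulf_neq0 ?oppr_eq0 //.
  by rewrite lt0r_neq0 ?addr_gt0.
- near=> k; rewrite low_branchE; set v := low_curvature k.
have hv : a * (k ^+ 2) ^+ 2 * (v ^+ 2) ^+ 2 - (P * k ^+ 2 + B) * v ^+ 2 + c = 0.
  exact: low_curvature_curve.
transitivity (- k ^+ 2 * (a * (k ^+ 2) ^+ 2 * (al (k ^+ 2) ^+ 2) ^+ 2
    - (P * k ^+ 2 + B) * al (k ^+ 2) ^+ 2 + c
    - (a * (k ^+ 2) ^+ 2 * (v ^+ 2) ^+ 2 - (P * k ^+ 2 + B) * v ^+ 2 + c))).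
  by rewrite /E -/v /al; ring.
rewrite hv subr0.
transitivity (k ^+ 8 * p (k ^+ 2) - k ^+ 2 * ((c - B * c1 ^+ 2)
    - c1 * (P * c1 + 2 * B * c2) * k ^+ 2
    + (a * c1 ^+ 4 - 2 * P * c1 * c2 - B * (c2 ^+ 2 + 2 * c1 * c3)) * k ^+ 4)).
  by rewrite /p /r /al; ring.
by rewrite h1 h2 h3; ring.
Unshelve. all: by end_near. Qed.

Lemma low_branch0 : low_branch 0 = 0.
Proof. by rewrite low_branchE expr0n mul0r. Qed.

Lemma low_branch_cvg_sqr : low_branch k / k ^+ 2 @[k --> 0^'] --> low_curvature 0.
Proof.
have := low_curvature_continuous 0; move/continuous_withinNx; apply: cvg_trans.
apply: near_eq_cvg; near=> k; have k0 : k != 0 by near: k; exact: nbhs_dnbhs_neq.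
by rewrite low_branchE mulrAC divff ?mul1r // expf_neq0.
Unshelve. all: by end_near. Qed.

(** The difference quotient at 0 is h times [low_curvature h], and the second factor has a finite
    limit. *)
Lemma is_derive_low_branch0 : is_derive (0 : R) 1 low_branch 0.
Proof.
have d0 : h^-1 *: ((low_branch \o shift 0) (h *: (1 : R)) - low_branch 0)
    @[h --> 0^'] --> (0 : R).
  apply: (@cvg_trans _ (h * low_curvature h @[h --> 0^'])).
    apply: near_eq_cvg; near=> x.
    have x0 : x != 0 by near: x; exact: nbhs_dnbhs_neq.
    rewrite low_branch0 subr0 /= addr0 /GRing.scale /= mulr1 low_branchE.
    by field.
  have idc : x @[x --> (0 : R)^'] --> (0 : R) by exact: nbhs_dnbhs.
  have vc : low_curvature x @[x --> (0 : R)^'] --> low_curvature 0.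
    by apply/continuous_withinNx; exact: low_curvature_continuous.
  by have idvc := cvgM idc vc; rewrite mul0r in idvc; exact: idvc.
by split; [apply/cvg_ex; exists 0|exact/cvg_lim].
Unshelve. all: by end_near. Qed.

(** The discriminant rescaled for y = 1/k: it is [disc (k ^+ 2)] divided by k^4, and it extends
    continuously to y = 0. *)
Let infty_disc (y : R) := (P + B * y ^+ 2) ^+ 2 - 4 * a * c.

Let branch_homogeneous (eps k : R) : k != 0 ->
  Num.sqrt ((P * k ^+ 2 + B + eps * Num.sqrt (disc (k ^+ 2))) / (2 * a)) =
  `|k| * Num.sqrt ((P + B * k^-1 ^+ 2 + eps * Num.sqrt (infty_disc k^-1)) / (2 * a)).
Proof.
move=> k0; rewrite -sqrtr_sqr -sqrtrM ?sqr_ge0 //; congr Num.sqrt.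
have -> : disc (k ^+ 2) = (k ^+ 2) ^+ 2 * infty_disc k^-1.
  by rewrite /curve_disc /infty_disc; field.
rewrite sqrtrM ?sqr_ge0 // sqrtr_sqr ger0_norm ?sqr_ge0 //.
by field; rewrite a_neq0.
Qed.

(** Both branches at once, [eps] being the sign of the radical. At y = 0 the rescaled discriminant
    is q^2, whence |q|. *)
Let branch_slope (eps q : R) (f : R -> R) :
  0 < (P + eps * `|q|) / (2 * a) -> q ^+ 2 = P ^+ 2 - 4 * a * c ->
  (forall k, f k =
    Num.sqrt ((P * k ^+ 2 + B + eps * Num.sqrt (disc (k ^+ 2))) / (2 * a))) ->
  asymptotic_slope f (Num.sqrt ((P + eps * `|q|) / (2 * a))).
Proof.
move=> s0 q2 fE; apply: (@asymptotic_slope_norm _ _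
  (fun y => Num.sqrt ((P + B * y ^+ 2 + eps * Num.sqrt (infty_disc y)) / (2 * a)))).
- by rewrite gt_eqF ?sqrtr_gt0.
- rewrite -sqrtr_sqr q2 (_ : Num.sqrt _ = Num.sqrt
    ((P + B * 0 ^+ 2 + eps * Num.sqrt (infty_disc 0)) / (2 * a))).
    by rewrite /infty_disc; solve_cvg.
  by rewrite /infty_disc expr0n /= mulr0 !addr0.
- by move=> k k0; rewrite fE branch_homogeneous.
Qed.

Lemma low_branch_slope (q : R) : q ^+ 2 = P ^+ 2 - 4 * a * c ->
  asymptotic_slope low_branch (Num.sqrt ((P - `|q|) / (2 * a))).
Proof.
move=> q2; rewrite -[`|q|]mul1r -mulNr; apply: branch_slope => //.
  (* The slope is nonzero because q^2 = P^2 - 4ac < P^2. *)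
  rewrite mulN1r divr_gt0 ?mulr_gt0 // subr_gt0.
  rewrite -(ltr_pXn2r (_ : 0 < 2)%N) ?nnegrE ?normr_ge0 ?(ltW P_gt0) //.
  by rewrite real_normK ?num_real // q2 gtrBl !mulr_gt0.
by move=> k; rewrite /low_branch /low_root mulN1r.
Qed.

Lemma up_branch_slope (q : R) : q ^+ 2 = P ^+ 2 - 4 * a * c ->
  asymptotic_slope up_branch (Num.sqrt ((P + `|q|) / (2 * a))).
Proof.
move=> q2; rewrite -[`|q|]mul1r; apply: branch_slope => //.
  by rewrite mul1r divr_gt0 ?mulr_gt0 // ltr_wpDr.
by move=> k; rewrite /up_branch /up_root mul1r.
Qed.

End BranchExpansions.

(** * Branches as the solution set of the curve *)

Section BranchCharacterization.
Variables (R : realType) (a c P B : R).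
Hypotheses (a_gt0 : 0 < a) (c_gt0 : 0 < c) (P_gt0 : 0 < P) (B_gt0 : 0 < B).
Hypothesis P_disc : 4 * a * c <= P ^+ 2.

Lemma eq_sqrP (x y : R) : x ^+ 2 = y ^+ 2 <-> x = y \/ x = - y.
Proof.
split=> [/eqP|[->|->]]; rewrite ?sqrrN // eqf_sqr.
by move=> /orP[] /eqP; [left|right].
Qed.

Lemma low_branchP (k w : R) :
  k ^+ 2 = w ^+ 2 *
    ((P + Num.sqrt (P ^+ 2 - 4 * a * c + 4 * c * B / w ^+ 2)) / (2 * c)) <->
  w = low_branch R a c P B k \/ w = - low_branch R a c P B k.
Proof.
rewrite -eq_sqrP low_branch_sqr //; have [->|w0] := eqVneq w 0.
  (* At w = 0 the factor w^2 removes the value of the division, leaving k^2 = 0. Conversely the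
     lower root vanishes only at k = 0: if [low_curvature] vanished, its equation would give c =
     0. *)
  rewrite [0 ^+ 2]expr0n /= mul0r; split=> [->|/eqP]; first by rewrite low_root0.
  rewrite eq_sym -low_branch_sqr // low_branchE // sqrf_eq0 mulf_eq0.
  case/orP=> /eqP // v0.
  have : a * (k ^+ 2) ^+ 2 * (low_curvature R a c P B k ^+ 2) ^+ 2
      - (P * k ^+ 2 + B) * low_curvature R a c P B k ^+ 2 + c = 0.
    exact: low_curvature_curve.
  by rewrite v0 !expr0n /= !mulr0 subr0 add0r => c0; move: c_gt0; rewrite c0 ltxx.
by apply: slowness_low_root; rewrite ?sqr_ge0 // exprn_even_gt0.
Qed.

Lemma up_branchP (k w : R) :
  (w != 0 /\ k ^+ 2 = w ^+ 2 *
    ((P - Num.sqrt (P ^+ 2 - 4 * a * c + 4 * c * B / w ^+ 2)) / (2 * c))) <->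
  w = up_branch R a c P B k \/ w = - up_branch R a c P B k.
Proof.
rewrite -eq_sqrP up_branch_sqr //; split=> [[w0]|wk].
  by apply: (slowness_up_root _ _ _ _ _ _ _ _ _ _ _ _ _ _).1;
    rewrite ?sqr_ge0 // exprn_even_gt0.
have w2 : 0 < w ^+ 2 by rewrite wk up_root_gt0 // sqr_ge0.
split; first by move: w2; rewrite exprn_even_gt0.
by apply/slowness_up_root; rewrite ?sqr_ge0.
Qed.

Lemma curve_branchP (k w : R) :
  a * (w ^+ 2) ^+ 2 - (P * k ^+ 2 + B) * w ^+ 2 + c * (k ^+ 2) ^+ 2 = 0 <->
  [\/ w = low_branch R a c P B k, w = - low_branch R a c P B k,
      w = up_branch R a c P B k | w = - up_branch R a c P B k].
Proof.
rewrite curveP ?sqr_ge0 // -low_branch_sqr // -up_branch_sqr // !eq_sqrP.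
split=> [[[]|[]]|[]] ->.
all: by [constructor 1|constructor 2|constructor 3|constructor 4
        |left; left|left; right|right; left|right; right].
Qed.

(** P^2 minus the radicand is 4ac/W times (W - B/a); this is the origin of the threshold. *)
Lemma slowness_minus_ge0 (W : R) : 0 < W ->
  (0 <= (P - Num.sqrt (P ^+ 2 - 4 * a * c + 4 * c * B / W)) / (2 * c)) = (B / a <= W).
Proof.
move=> W0; rewrite pmulr_lge0 ?invr_gt0 ?mulr_gt0 // subr_ge0.
rewrite -[P in _ <= P](ger0_norm (ltW P_gt0)) -sqrtr_sqr ler_sqrt ?sqr_ge0 //.
rewrite -subr_ge0 (_ : _ - _ = 4 * a * c / W * (W - B / a)); last first.
  by field; rewrite !lt0r_neq0.
by rewrite pmulr_rge0 ?subr_ge0 // divr_gt0 // !mulr_gt0.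
Qed.

End BranchCharacterization.

(** * The Mindlin-Reissner coefficients *)

(** Fractional powers in the series coefficients are reduced to square roots, which makes the
    coefficient identities rational. *)
Lemma powR_three_halves (R : realType) (x : R) : 0 < x -> x `^ (3 / 2) = x * Num.sqrt x.
Proof.
move=> x0; have -> : 3 / 2 = 1 + 2^-1 :> R by field.
by rewrite powRD ?gt_eqF ?implybT // powRr1 ?powR12_sqrt // ltW.
Qed.

Lemma powR_five_halves (R : realType) (x : R) : 0 < x -> x `^ (5 / 2) = x ^+ 2 * Num.sqrt x.
Proof.
move=> x0; have -> : 5 / 2 = 2 + 2^-1 :> R by field.
by rewrite powRD ?gt_eqF ?implybT // powR_mulrn ?powR12_sqrt // ltW.
Qed.

Section MindlinReissner.
Variables (R : realType) (rho h D kappa G b : R).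
Hypotheses (hrho : 0 < rho) (hh : 0 < h) (hD : 0 < D).
Hypotheses (hkappa : 0 < kappa) (hG : 0 < G) (hb : 0 < b).

Local Notation a := (rho ^+ 2 * h ^+ 3 / 12).
Local Notation c := (kappa * G * D).
Local Notation B := (b ^+ 2 * kappa * G * rho * h).
Local Notation P := (coefP rho h D kappa G).
Local Notation Q := (coefQ rho h D kappa G).
Local Notation Rc := (coefR rho h D kappa G b).
Local Notation wL := (low_branch R a c P B).
Local Notation wU := (up_branch R a c P B).

Let a_gt0 : 0 < a. Proof. by rewrite divr_gt0 // mulr_gt0 ?exprn_gt0. Qed.
Let c_gt0 : 0 < c. Proof. by rewrite !mulr_gt0. Qed.
Let B_gt0 : 0 < B. Proof. by rewrite !mulr_gt0 ?exprn_gt0. Qed.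
Let P_gt0 : 0 < P.
Proof. by rewrite addr_gt0 ?divr_gt0 ?mulr_gt0 ?exprn_gt0. Qed.
Let Rc_gt0 : 0 < Rc.
Proof. by rewrite !mulr_gt0 // sqrtr_gt0 !mulr_gt0. Qed.

Lemma coefQ_sqr : Q ^+ 2 = P ^+ 2 - 4 * a * c.
Proof. by rewrite /coefQ /coefP; field. Qed.

Lemma coefR_sqr : Rc ^+ 2 = 4 * c * B.
Proof.
rewrite /coefR exprMn sqr_sqrtr; last by rewrite !mulr_ge0 // ltW.
by ring.
Qed.

Let P_disc : 4 * a * c <= P ^+ 2.
Proof. by rewrite -subr_ge0 -coefQ_sqr sqr_ge0. Qed.

Lemma dispersionE (k w : R) : dispersion rho h D kappa G b k w =
  a * (w ^+ 2) ^+ 2 - (P * k ^+ 2 + B) * w ^+ 2 + c * (k ^+ 2) ^+ 2.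
Proof. by rewrite /dispersion /coefP; field. Qed.

Lemma dispersion_slowness (k w : R) : w != 0 ->
  dispersion rho h D kappa G b k w = 0 <->
  c * (k ^+ 2 / w ^+ 2) ^+ 2 - P * (k ^+ 2 / w ^+ 2) + a = B / w ^+ 2.
Proof.
move=> w0; have -> : dispersion rho h D kappa G b k w = (w ^+ 2) ^+ 2 *
    (c * (k ^+ 2 / w ^+ 2) ^+ 2 - P * (k ^+ 2 / w ^+ 2) + a - B / w ^+ 2).
  by rewrite dispersionE; field.
split=> [/eqP|->]; last by rewrite subrr mulr0.
by rewrite !mulf_eq0 (negbTE w0) /= subr_eq0 => /eqP.
Qed.

Let denE : 2 * kappa * G * D = 2 * c. Proof. by rewrite !mulrA. Qed.

(* S_+ and S_- are the cases eps = 1 and eps = -1 of the generic expansions. *)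
Lemma SplusE : Splus rho h D kappa G b =
  fun w => (P + 1 * Num.sqrt (Q ^+ 2 + Rc ^+ 2 / w ^+ 2)) / (2 * c).
Proof. by apply/funext => w; rewrite /Splus denE mul1r. Qed.

Lemma SminusE : Sminus rho h D kappa G b =
  fun w => (P + (-1) * Num.sqrt (Q ^+ 2 + Rc ^+ 2 / w ^+ 2)) / (2 * c).
Proof. by apply/funext => w; rewrite /Sminus denE mulN1r. Qed.

Lemma slowness_roots (w S : R) : w != 0 ->
  c * S ^+ 2 - P * S + a = B / w ^+ 2 <->
  S = Splus rho h D kappa G b w \/ S = Sminus rho h D kappa G b w.
Proof.
move=> w0; rewrite SplusE SminusE mul1r mulN1r.
have d0 : 0 <= Q ^+ 2 + Rc ^+ 2 / w ^+ 2.
  by rewrite addr_ge0 ?sqr_ge0 // divr_ge0 ?sqr_ge0.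
have c0 : c != 0 by exact: lt0r_neq0.
set s := Num.sqrt _.
have s2 : s ^+ 2 = P ^+ 2 - 4 * a * c + 4 * c * B / w ^+ 2.
  by rewrite sqr_sqrtr // coefQ_sqr coefR_sqr.
have E : c * S ^+ 2 - P * S + a - B / w ^+ 2 =
    c * (S - (P + s) / (2 * c)) * (S - (P - s) / (2 * c)).
  transitivity (c * S ^+ 2 - P * S + (P ^+ 2 - s ^+ 2) / (4 * c)).
    by rewrite s2; field; rewrite w0 !gt_eqF.
  by field; rewrite !gt_eqF.
split=> [/eqP|H].
  rewrite -subr_eq0 E mulf_eq0 [X in X || _]mulf_eq0 (negbTE c0) /= !subr_eq0.
  by move=> /orP[] /eqP; [left|right].
apply/eqP; rewrite -subr_eq0 E; case: H => ->; rewrite subrr ?mulr0 ?mul0r //.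
Qed.

Lemma on_lowerP (k w : R) :
  on_lower rho h D kappa G b k w <-> w = wL k \/ w = - wL k.
Proof.
by rewrite -low_branchP // /on_lower SplusE mul1r coefQ_sqr coefR_sqr.
Qed.

Lemma on_upperP (k w : R) :
  on_upper rho h D kappa G b k w <-> w = wU k \/ w = - wU k.
Proof.
by rewrite -up_branchP // /on_upper SminusE mulN1r coefQ_sqr coefR_sqr.
Qed.

Lemma Sminus_ge0 (w : R) : w != 0 ->
  (0 <= Sminus rho h D kappa G b w) = (B / a <= w ^+ 2).
Proof.
move=> w0; rewrite SminusE mulN1r coefQ_sqr coefR_sqr slowness_minus_ge0 //.
by rewrite exprn_even_gt0.
Qed.

Lemma Splus_gt0 (w : R) : 0 < Splus rho h D kappa G b w.
Proof.
by rewrite SplusE mul1r divr_gt0 ?mulr_gt0 // ltr_wpDr // sqrtr_ge0.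
Qed.

Lemma Sminus_lt_Splus (w : R) : w != 0 ->
  Sminus rho h D kappa G b w < Splus rho h D kappa G b w.
Proof.
move=> w0; rewrite SplusE SminusE mul1r mulN1r ltr_pM2r ?invr_gt0 ?mulr_gt0 //.
have : 0 < Num.sqrt (Q ^+ 2 + Rc ^+ 2 / w ^+ 2).
  rewrite sqrtr_gt0 ltr_wpDl ?sqr_ge0 //.
  by apply: divr_gt0; rewrite exprn_even_gt0 //= gt_eqF.
by rewrite ltrD2l => s0; rewrite (lt_trans _ s0) // oppr_lt0.
Qed.

Local Notation w0 := (2 * b * Num.sqrt (3 * kappa * G) / (Num.sqrt rho * h)).

Lemma threshold_sqr : w0 ^+ 2 = 12 * b ^+ 2 * kappa * G / (rho * h ^+ 2).
Proof.
rewrite expr_div_n !exprMn !sqr_sqrtr ?(ltW hrho) ?mulr_ge0 ?ltW //.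
by congr (_ / _); ring.
Qed.

Lemma threshold_gt0 : 0 < w0.
Proof. by rewrite divr_gt0 // !mulr_gt0 // sqrtr_gt0 // !mulr_gt0. Qed.

Lemma threshold_root : a * w0 ^+ 2 = B.
Proof. by rewrite threshold_sqr; field; rewrite !gt_eqF. Qed.

(** For nonzero w a real k exists exactly when S_- is nonnegative, that is when w^2 reaches B/a, the
    square of the threshold. *)
Lemma ex_on_upper (w : R) : (exists k, on_upper rho h D kappa G b k w) <-> w0 <= `|w|.
Proof.
have sqr_le : (B / a <= w ^+ 2) = (w0 <= `|w|).
  rewrite -threshold_root mulrAC divff ?gt_eqF // mul1r.
  rewrite -[w ^+ 2]real_normK ?num_real //.
  by rewrite ler_pXn2r ?nnegrE // ltW // threshold_gt0.
split=> [[k [w_neq0 kw]]|].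
  rewrite -sqr_le -Sminus_ge0 // -(pmulr_rge0 _ (_ : 0 < w ^+ 2)) -?kw ?sqr_ge0 //.
  by rewrite exprn_even_gt0.
move=> w0w; have w_neq0 : w != 0.
  by rewrite -normr_gt0 (lt_le_trans threshold_gt0).
exists (Num.sqrt (w ^+ 2 * Sminus rho h D kappa G b w)).
split=> //; rewrite sqr_sqrtr // mulr_ge0 ?sqr_ge0 //.
by rewrite Sminus_ge0 // sqr_le.
Qed.

Lemma low_branch_series :
  let c1 := Num.sqrt D / (b * Num.sqrt (rho * h)) in
  let c2 := - (Num.sqrt D * (12 * D + kappa * G * h ^+ 3)
               / (24 * kappa * G * b ^+ 3 * h `^ (3 / 2) * Num.sqrt rho)) in
  let c3 := Num.sqrt D * (4 * D + kappa * G * h ^+ 3)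
              * (36 * D + kappa * G * h ^+ 3)
            / (384 * kappa ^+ 2 * G ^+ 2 * b ^+ 5 * h `^ (5 / 2)
               * Num.sqrt rho) in
  wL = (fun k : R => c1 * k ^+ 2 + c2 * k ^+ 4 + c3 * k ^+ 6)
    +O_ (nbhs 0) (fun k : R => k ^+ 8).
Proof.
rewrite /= powR_three_halves // powR_five_halves // sqrtrM ?(ltW hrho) //.
have t0 : 0 < Num.sqrt D by rewrite sqrtr_gt0.
have u0 : 0 < Num.sqrt rho by rewrite sqrtr_gt0.
have v0 : 0 < Num.sqrt h by rewrite sqrtr_gt0.
have t2 := sqr_sqrtr (ltW hD); have u2 := sqr_sqrtr (ltW hrho).
have v2 := sqr_sqrtr (ltW hh).
(* Writing D, rho and h as squares of [t], [u] and [v] turns the matching conditions into identities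
   of rational functions. *)
set t := Num.sqrt D in t0 t2 *; set u := Num.sqrt rho in u0 u2 *.
set v := Num.sqrt h in v0 v2 *.
apply: low_branch_expansion => //.
- by rewrite divr_gt0 // !mulr_gt0.
- by rewrite -t2 -u2 -v2; field; rewrite !gt_eqF.
- by rewrite /coefP -t2 -u2 -v2; field; rewrite !gt_eqF.
- by rewrite /coefP -t2 -u2 -v2; field; rewrite !gt_eqF.
Qed.

Lemma up_branch_series :
  let d1 := Num.sqrt 3 * (D + kappa * G * h ^+ 3 / 12)
            / (Num.sqrt (kappa * G) * b * h ^+ 2 * Num.sqrt rho) in
  let d2 := - (Num.sqrt 3 * (144 * D ^+ 2 + 72 * D * kappa * G * h ^+ 3
                             + kappa ^+ 2 * G ^+ 2 * h ^+ 6)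
               / (576 * (kappa * G) `^ (3 / 2) * b ^+ 3 * h ^+ 3
                  * Num.sqrt rho)) in
  wU = (fun k : R => w0 + d1 * k ^+ 2 + d2 * k ^+ 4)
    +O_ (nbhs 0) (fun k : R => k ^+ 6).
Proof.
have K0 : 0 < kappa * G by rewrite mulr_gt0.
rewrite /= powR_three_halves //.
have w0E : w0 = 2 * b * (Num.sqrt 3 * Num.sqrt (kappa * G)) / (Num.sqrt rho * h).
  by rewrite -(mulrA 3) sqrtrM.
have s3 : Num.sqrt 3 ^+ 2 = 3 :> R by rewrite sqr_sqrtr.
have g0 : 0 < Num.sqrt (kappa * G) by rewrite sqrtr_gt0.
have u0 : 0 < Num.sqrt rho by rewrite sqrtr_gt0.
have g2 := sqr_sqrtr (ltW K0); have u2 := sqr_sqrtr (ltW hrho).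
apply: up_branch_expansion => //; [exact: threshold_gt0|exact: threshold_root|..].
all: rewrite w0E; move: g0 g2 u0 u2 s3.
all: set s := Num.sqrt 3; set g := Num.sqrt (kappa * G); set u := Num.sqrt rho.
all: move=> g0 g2 u0 u2 s3.
(* The root [g] only sees the product of kappa and G, so kappa is eliminated as g^2/G. *)
all: have kE : kappa = g ^+ 2 / G by rewrite g2 mulfK ?gt_eqF.
(* The relation s^2 = 3 is unknown to [field]; the factor s^2/3 = 1 gives both sides the same power
   of [s]. *)
- transitivity (s ^+ 2 / 3 * P); last by rewrite s3 divff ?mul1r.
  by rewrite /coefP kE -u2; field; rewrite !gt_eqF.
- transitivity (s ^+ 2 / 3 * - c); last by rewrite s3 divff ?mul1r.
  by rewrite kE -u2; field; rewrite !gt_eqF.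
Qed.

Lemma slowness_infty_roots (S : R) :
  c * S ^+ 2 - P * S + a = 0 <->
  S = Splus_infty rho h D kappa G \/ S = Sminus_infty rho h D kappa G.
Proof.
have c0 : c != 0 by exact: lt0r_neq0.
rewrite /Splus_infty /Sminus_infty denE; set s := `|Q|.
have s2 : s ^+ 2 = P ^+ 2 - 4 * a * c by rewrite real_normK ?num_real // coefQ_sqr.
have -> : c * S ^+ 2 - P * S + a = c * (S - (P + s) / (2 * c)) * (S - (P - s) / (2 * c)).
  transitivity (c * S ^+ 2 - P * S + (P ^+ 2 - s ^+ 2) / (4 * c)).
    by rewrite s2; field; rewrite !gt_eqF.
  by field; rewrite !gt_eqF.
split=> [/eqP|].
  rewrite mulf_eq0 [X in X || _]mulf_eq0 (negbTE c0) /= !subr_eq0.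
  by move=> /orP[] /eqP; [left|right].
by case=> ->; rewrite subrr ?mulr0 ?mul0r.
Qed.

(** P + Q retains the bending data and P - Q the shear data, so the sign of Q decides which of the
    roots P + |Q| and P - |Q| belongs to which factor. *)
Lemma coefPQ : P + Q = 2 * (rho * h ^+ 3 * kappa * G / 12) /\ P - Q = 2 * (rho * D).
Proof. by rewrite /coefP /coefQ; split; field. Qed.

Lemma slowness_infty_le0 : Q <= 0 ->
  Splus_infty rho h D kappa G = rho / (kappa * G) /\
  Sminus_infty rho h D kappa G = rho * h ^+ 3 / (12 * D).
Proof.
move=> Q0; rewrite /Splus_infty /Sminus_infty ler0_norm // opprK.
by have [-> ->] := coefPQ; split; field; rewrite !gt_eqF.
Qed.

Lemma slowness_infty_ge0 : 0 <= Q ->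
  Splus_infty rho h D kappa G = rho * h ^+ 3 / (12 * D) /\
  Sminus_infty rho h D kappa G = rho / (kappa * G).
Proof.
move=> Q0; rewrite /Splus_infty /Sminus_infty ger0_norm //.
by have [-> ->] := coefPQ; split; field; rewrite !gt_eqF.
Qed.

Local Notation slope1 := (Num.sqrt (kappa * G / rho)).
Local Notation slope2 := (Num.sqrt (12 * D / (rho * h ^+ 3))).

(** Since P^2 - Q^2 = 4ac, the squared slope (P - |Q|)/(2a) is the inverse of the limit of S_+: the
    lower branch carries the larger slowness. *)
Lemma branch_slopes_le0 : Q <= 0 ->
  asymptotic_slope wL slope1 /\ asymptotic_slope wU slope2.
Proof.
move=> Q0; have [PQ PmQ] := coefPQ; split.
  have -> : slope1 = Num.sqrt ((P - `|Q|) / (2 * a)); last first.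
    by apply: low_branch_slope => //; exact: coefQ_sqr.
  by rewrite ler0_norm // opprK PQ; congr Num.sqrt; field; rewrite !gt_eqF.
have -> : slope2 = Num.sqrt ((P + `|Q|) / (2 * a)); last first.
  by apply: up_branch_slope => //; exact: coefQ_sqr.
by rewrite ler0_norm // PmQ; congr Num.sqrt; field; rewrite !gt_eqF.
Qed.

Lemma branch_slopes_ge0 : 0 <= Q ->
  asymptotic_slope wL slope2 /\ asymptotic_slope wU slope1.
Proof.
move=> Q0; have [PQ PmQ] := coefPQ; split.
  have -> : slope2 = Num.sqrt ((P - `|Q|) / (2 * a)); last first.
    by apply: low_branch_slope => //; exact: coefQ_sqr.
  by rewrite ger0_norm // PmQ; congr Num.sqrt; field; rewrite !gt_eqF.
have -> : slope1 = Num.sqrt ((P + `|Q|) / (2 * a)); last first.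
  by apply: up_branch_slope => //; exact: coefQ_sqr.
by rewrite ger0_norm // PQ; congr Num.sqrt; field; rewrite !gt_eqF.
Qed.

(** Q has the sign of kappa/2 - 1/(1 - nu), and kappa/2 <= 1/2 < 1/(1 - nu) because 0 < 1 - nu <
    2. *)
Lemma coefQ_lt0 (E nu : R) : 0 < E -> -1 < nu < 1 -> kappa <= 1 ->
  G = E / (2 * (1 + nu)) -> D = E * h ^+ 3 / (12 * (1 - nu ^+ 2)) -> Q < 0.
Proof.
move=> E0 /andP[nu1 nu2] k1 GE DE.
have p1 : 0 < 1 + nu by rewrite -ltrBlDl sub0r.
have p2 : 0 < 1 - nu by rewrite subr_gt0.
have -> : Q = rho * h ^+ 3 / 12 * (E / (1 + nu)) * (kappa / 2 - (1 - nu)^-1).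
  rewrite /coefQ GE DE.
  have -> : 1 - nu ^+ 2 = (1 - nu) * (1 + nu) by ring.
  by field; rewrite !gt_eqF.
rewrite pmulr_rlt0; last by rewrite mulr_gt0 ?divr_gt0 ?mulr_gt0 ?exprn_gt0.
rewrite subr_lt0 (@le_lt_trans _ _ 2^-1) //.
  by rewrite ler_pdivrMr // mulVf.
by rewrite ltf_pV2 ?posrE //; lra.
Qed.

Lemma slope_line (p q k w : R) : 0 < p -> 0 < q ->
  p * w ^+ 2 - q * k ^+ 2 = 0 <->
  w = Num.sqrt (q / p) * k \/ w = - (Num.sqrt (q / p) * k).
Proof.
move=> p0 q0; rewrite -eq_sqrP exprMn sqr_sqrtr ?divr_ge0 ?ltW //.
have -> : p * w ^+ 2 - q * k ^+ 2 = p * (w ^+ 2 - q / p * k ^+ 2).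
  by field; rewrite gt_eqF.
split=> [/eqP|->]; last by rewrite subrr mulr0.
by rewrite mulf_eq0 gt_eqF //= subr_eq0 => /eqP.
Qed.

Lemma shear_line (k w : R) :
  rho * w ^+ 2 - kappa * G * k ^+ 2 = 0 <-> w = slope1 * k \/ w = - (slope1 * k).
Proof. by apply: slope_line; rewrite ?mulr_gt0. Qed.

Lemma bending_line (k w : R) :
  rho * h ^+ 3 / 12 * w ^+ 2 - D * k ^+ 2 = 0 <-> w = slope2 * k \/ w = - (slope2 * k).
Proof.
rewrite slope_line ?divr_gt0 ?mulr_gt0 ?exprn_gt0 //.
by have -> : D / (rho * h ^+ 3 / 12) = 12 * D / (rho * h ^+ 3) by field; rewrite !gt_eqF.
Qed.

Lemma Splus_series :
  Splus rho h D kappa G b =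
  (fun w : R => Rc / (2 * kappa * G * D) * `|w|^-1 + P / (2 * kappa * G * D)
                + Q ^+ 2 / (4 * kappa * G * D * Rc) * `|w|
                - Q ^+ 4 / (16 * kappa * G * D * Rc ^+ 3) * `|w| ^+ 3)
  +O_ (0^') (fun w : R => `|w| ^+ 5).
Proof.
have -> : (fun w : R => Rc / (2 * kappa * G * D) * `|w|^-1 + P / (2 * kappa * G * D)
                + Q ^+ 2 / (4 * kappa * G * D * Rc) * `|w|
                - Q ^+ 4 / (16 * kappa * G * D * Rc ^+ 3) * `|w| ^+ 3) =
    (fun w => 1 * (Rc / (2 * c) * `|w|^-1) + P / (2 * c)
            + 1 * (Q ^+ 2 / (4 * c * Rc) * `|w|)
            - 1 * (Q ^+ 4 / (16 * c * Rc ^+ 3) * `|w| ^+ 3)).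
  by apply/funext => w; rewrite !mul1r !mulrA.
rewrite SplusE.
exact: (slowness_expansion _ _ _ _ _ _ Rc_gt0 (lt0r_neq0 c_gt0)).
Qed.

Lemma Sminus_series :
  Sminus rho h D kappa G b =
  (fun w : R => - (Rc / (2 * kappa * G * D) * `|w|^-1) + P / (2 * kappa * G * D)
                - Q ^+ 2 / (4 * kappa * G * D * Rc) * `|w|
                + Q ^+ 4 / (16 * kappa * G * D * Rc ^+ 3) * `|w| ^+ 3)
  +O_ (0^') (fun w : R => `|w| ^+ 5).
Proof.
have -> : (fun w : R => - (Rc / (2 * kappa * G * D) * `|w|^-1) + P / (2 * kappa * G * D)
                - Q ^+ 2 / (4 * kappa * G * D * Rc) * `|w|
                + Q ^+ 4 / (16 * kappa * G * D * Rc ^+ 3) * `|w| ^+ 3) =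
    (fun w => (-1) * (Rc / (2 * c) * `|w|^-1) + P / (2 * c)
            + (-1) * (Q ^+ 2 / (4 * c * Rc) * `|w|)
            - (-1) * (Q ^+ 4 / (16 * c * Rc ^+ 3) * `|w| ^+ 3)).
  by apply/funext => w; rewrite !mulN1r opprK !mulrA.
rewrite SminusE.
exact: (slowness_expansion _ _ _ _ _ _ Rc_gt0 (lt0r_neq0 c_gt0)).
Qed.

Lemma Splus_sqr_equiv :
  (fun w : R => w ^+ 2 * Splus rho h D kappa G b w)
  ~_ (0^') (fun w : R => Rc * `|w| / (2 * kappa * G * D)).
Proof.
rewrite denE SplusE.
under eq_fun do rewrite mul1r.
exact: (slowness_sqr_equiv _ _ _ _ _ Rc_gt0 (lt0r_neq0 c_gt0)).
Qed.

End MindlinReissner.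

(** * Limits of the slownesses and the decoupled lines *)

Section MindlinReissnerLimits.
Variables (R : realType) (rho h D kappa G b : R).
Hypotheses (hrho : 0 < rho) (hh : 0 < h) (hD : 0 < D).
Hypotheses (hkappa : 0 < kappa) (hG : 0 < G) (hb : 0 < b).

Lemma Splus_sqr_cvg0 : w ^+ 2 * Splus rho h D kappa G b w @[w --> 0^'] --> 0.
Proof.
have t0 := @cvg_abs0 R; have c0 : kappa * G * D != 0 by rewrite gt_eqF ?mulr_gt0.
set P := coefP rho h D kappa G; set Q := coefQ rho h D kappa G.
set r := coefR rho h D kappa G b.
have H : `|w| * ((P * `|w| + Num.sqrt (r ^+ 2 + Q ^+ 2 * `|w| ^+ 2)) / (2 * (kappa * G * D)))
    @[w --> (0 : R)^'] -->
    0 * ((P * 0 + Num.sqrt (r ^+ 2 + Q ^+ 2 * 0 ^+ 2)) / (2 * (kappa * G * D))).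
  by solve_cvg.
rewrite mul0r in H; apply: cvg_trans H; apply: near_eq_cvg; near=> w.
have w0 : w != 0 by near: w; exact: nbhs_dnbhs_neq.
have w1 : `|w| != 0 by rewrite normr_eq0.
rewrite SplusE slowness_scaled // -/P -/Q -/r -[w ^+ 2]real_normK ?num_real //.
by field; rewrite w1 !gt_eqF.
Unshelve. all: by end_near. Qed.

Lemma near_Sminus_lt0 :
  \forall w \near (0 : R)^', Sminus rho h D kappa G b w < 0 /\
    ~ exists k : R, on_upper rho h D kappa G b k w.
Proof.
near=> w.
have w0 : w != 0 by near: w; exact: nbhs_dnbhs_neq.
have w1 : `|w| < 2 * b * Num.sqrt (3 * kappa * G) / (Num.sqrt rho * h).
  by near: w; apply: cvgr_lt (@cvg_abs0 R) _ _; exact: threshold_gt0.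
have nex : ~ exists k : R, on_upper rho h D kappa G b k w.
  by rewrite ex_on_upper // leNgt w1.
(* If S_- were nonnegative, the root of w^2 S_- would be a real k below the threshold. *)
split=> //; rewrite ltNge; apply/negP => Sm0; apply: nex.
exists (Num.sqrt (w ^+ 2 * Sminus rho h D kappa G b w)); split=> //.
by rewrite sqr_sqrtr // mulr_ge0 ?sqr_ge0.
Unshelve. all: by end_near. Qed.

Lemma cvg_div_sqr_pinfty (x : R) : x / w ^+ 2 @[w --> +oo] --> 0.
Proof.
have i0 := @cvg_inv_pinfty R.
have H : x * w^-1 ^+ 2 @[w --> +oo] --> x * 0 ^+ 2 by solve_cvg.
rewrite expr0n /= mulr0 in H; apply: cvg_trans H.
by apply: near_eq_cvg; apply: nearW => w; rewrite exprVn.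
Qed.

Lemma cvg_div_sqr_ninfty (x : R) : x / w ^+ 2 @[w --> -oo] --> 0.
Proof.
have i0 := @cvg_inv_ninfty R.
have H : x * w^-1 ^+ 2 @[w --> -oo] --> x * 0 ^+ 2 by solve_cvg.
rewrite expr0n /= mulr0 in H; apply: cvg_trans H.
by apply: near_eq_cvg; apply: nearW => w; rewrite exprVn.
Qed.

Lemma Splus_cvg_infty :
  (Splus rho h D kappa G b w @[w --> +oo] --> Splus_infty rho h D kappa G) /\
  (Splus rho h D kappa G b w @[w --> -oo] --> Splus_infty rho h D kappa G).
Proof.
rewrite SplusE /Splus_infty -[`|_|]mul1r -!(mulrA 2).
by split; [exact: slowness_cvg_pinfty|exact: slowness_cvg_ninfty].
Qed.

Lemma Sminus_cvg_infty :
  (Sminus rho h D kappa G b w @[w --> +oo] --> Sminus_infty rho h D kappa G) /\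
  (Sminus rho h D kappa G b w @[w --> -oo] --> Sminus_infty rho h D kappa G).
Proof.
rewrite SminusE /Sminus_infty -[- `|_|]mulN1r -!(mulrA 2).
by split; [exact: slowness_cvg_pinfty|exact: slowness_cvg_ninfty].
Qed.

Lemma uncoupled_dispersion (k w : R) : w != 0 ->
  dispersion rho h D kappa G 0 k w = 0 <->
  kappa * G * D * (k ^+ 2 / w ^+ 2) ^+ 2 - coefP rho h D kappa G * (k ^+ 2 / w ^+ 2)
    + rho ^+ 2 * h ^+ 3 / 12 = 0.
Proof. by move=> w0; rewrite dispersion_slowness // expr0n /= !mul0r. Qed.

Lemma uncoupled_lines (k w : R) :
  dispersion rho h D kappa G 0 k w = 0 <->
  [\/ w = Num.sqrt (kappa * G / rho) * k, w = - (Num.sqrt (kappa * G / rho) * k),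
      w = Num.sqrt (12 * D / (rho * h ^+ 3)) * k
    | w = - (Num.sqrt (12 * D / (rho * h ^+ 3)) * k)].
Proof.
have -> : dispersion rho h D kappa G 0 k w =
    (rho * h ^+ 3 / 12 * w ^+ 2 - D * k ^+ 2) * (rho * w ^+ 2 - kappa * G * k ^+ 2).
  by rewrite /dispersion expr0n /= !mul0r subr0.
have shear := shear_line _ _ _ _ hrho hkappa hG k w.
have bending := bending_line _ _ _ _ hrho hh hD k w.
split=> [/eqP|].
  rewrite mulf_eq0 => /orP[] /eqP.
    by move=> /bending[]; [constructor 3|constructor 4].
  by move=> /shear[]; [constructor 1|constructor 2].
by case=> H; apply/eqP; rewrite mulf_eq0; apply/orP;
  [right|right|left|left]; apply/eqP; (apply/shear || apply/bending); auto.
Qed.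

End MindlinReissnerLimits.

Theorem mainTheorem3 (R : realType) (rho h D kappa G b : R)
    (hrho : 0 < rho) (hh : 0 < h) (hD : 0 < D)
    (hkappa : 0 < kappa) (hG : 0 < G) (hb : 0 < b) :
  let A := dispersion rho h D kappa G b in
  let A0 := dispersion rho h D kappa G 0 in
  let P := coefP rho h D kappa G in
  let Q := coefQ rho h D kappa G in
  let Rc := coefR rho h D kappa G b in
  let Sp := Splus rho h D kappa G b in
  let Sm := Sminus rho h D kappa G b in
  let Spoo := Splus_infty rho h D kappa G in
  let Smoo := Sminus_infty rho h D kappa G in
  let lower := on_lower rho h D kappa G b in
  let upper := on_upper rho h D kappa G b in
  let c1 := Num.sqrt D / (b * Num.sqrt (rho * h)) in
  let c2 := - (Num.sqrt D * (12 * D + kappa * G * h ^+ 3)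
               / (24 * kappa * G * b ^+ 3 * h `^ (3 / 2) * Num.sqrt rho)) in
  let c3 := Num.sqrt D * (4 * D + kappa * G * h ^+ 3)
              * (36 * D + kappa * G * h ^+ 3)
            / (384 * kappa ^+ 2 * G ^+ 2 * b ^+ 5 * h `^ (5 / 2)
               * Num.sqrt rho) in
  let w0 := 2 * b * Num.sqrt (3 * kappa * G) / (Num.sqrt rho * h) in
  let d1 := Num.sqrt 3 * (D + kappa * G * h ^+ 3 / 12)
            / (Num.sqrt (kappa * G) * b * h ^+ 2 * Num.sqrt rho) in
  let d2 := - (Num.sqrt 3 * (144 * D ^+ 2 + 72 * D * kappa * G * h ^+ 3
                             + kappa ^+ 2 * G ^+ 2 * h ^+ 6)
               / (576 * (kappa * G) `^ (3 / 2) * b ^+ 3 * h ^+ 3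
                  * Num.sqrt rho)) in
  let slope1 := Num.sqrt (kappa * G / rho) in
  let slope2 := Num.sqrt (12 * D / (rho * h ^+ 3)) in
  (* (i) *)
  ((forall k w : R, w != 0 ->
      (A k w = 0 <->
       kappa * G * D * (k ^+ 2 / w ^+ 2) ^+ 2 - P * (k ^+ 2 / w ^+ 2)
         + rho ^+ 2 * h ^+ 3 / 12 = b ^+ 2 * kappa * G * rho * h / w ^+ 2)) /\
   (forall w : R, w != 0 ->
      Sm w < Sp w /\
      (forall S : R, kappa * G * D * S ^+ 2 - P * S + rho ^+ 2 * h ^+ 3 / 12
                   = b ^+ 2 * kappa * G * rho * h / w ^+ 2
                 <-> S = Sp w \/ S = Sm w)) /\
   Sp = (fun w : R => Rc / (2 * kappa * G * D) * `|w|^-1 + P / (2 * kappa * G * D)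
                  + Q ^+ 2 / (4 * kappa * G * D * Rc) * `|w|
                  - Q ^+ 4 / (16 * kappa * G * D * Rc ^+ 3) * `|w| ^+ 3)
        +O_ (0^') (fun w : R => `|w| ^+ 5) /\
   Sm = (fun w : R => - (Rc / (2 * kappa * G * D) * `|w|^-1)
                  + P / (2 * kappa * G * D)
                  - Q ^+ 2 / (4 * kappa * G * D * Rc) * `|w|
                  + Q ^+ 4 / (16 * kappa * G * D * Rc ^+ 3) * `|w| ^+ 3)
        +O_ (0^') (fun w : R => `|w| ^+ 5)) /\
  (* the four branches w = wL k, - wL k, wU k, - wU k *)
  exists wL wU : R -> R,
  (continuous wL /\ continuous wU /\
   (forall k : R, 0 <= wL k) /\ (forall k : R, wL k < wU k) /\
   (forall k w : R, lower k w <-> w = wL k \/ w = - wL k) /\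
   (forall k w : R, upper k w <-> w = wU k \/ w = - wU k) /\
   (forall k w : R, A k w = 0 <->
                [\/ w = wL k, w = - wL k, w = wU k | w = - wU k])) /\
  (* (ii) *)
  ((\forall w \near 0^', 0 < Sp w) /\
   (fun w : R => w ^+ 2 * Sp w) ~_ (0^')
     (fun w : R => Rc * `|w| / (2 * kappa * G * D)) /\
   w ^+ 2 * Sp w @[w --> 0^'] --> 0 /\
   wL 0 = 0 /\ is_derive (0 : R) 1 wL 0 /\
   0 < c1 /\ wL k / k ^+ 2 @[k --> 0^'] --> c1 /\
   wL = (fun k : R => c1 * k ^+ 2 + c2 * k ^+ 4 + c3 * k ^+ 6)
        +O_ (nbhs 0) (fun k : R => k ^+ 8)) /\
  (* (iii) *)
  ((\forall w \near 0^', Sm w < 0 /\ ~ exists k : R, upper k w) /\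
   (forall w : R, (exists k : R, upper k w) <-> w0 <= `|w|) /\
   w0 ^+ 2 = 12 * b ^+ 2 * kappa * G / (rho * h ^+ 2) /\
   wU = (fun k : R => w0 + d1 * k ^+ 2 + d2 * k ^+ 4)
        +O_ (nbhs 0) (fun k : R => k ^+ 6)) /\
  (* (iv) *)
  ((b ^+ 2 * kappa * G * rho * h / w ^+ 2 @[w --> +oo] --> 0 /\
    b ^+ 2 * kappa * G * rho * h / w ^+ 2 @[w --> -oo] --> 0) /\
   (forall k w : R, w != 0 ->
      (A0 k w = 0 <->
       kappa * G * D * (k ^+ 2 / w ^+ 2) ^+ 2 - P * (k ^+ 2 / w ^+ 2)
         + rho ^+ 2 * h ^+ 3 / 12 = 0)) /\
   (forall S : R, kappa * G * D * S ^+ 2 - P * S + rho ^+ 2 * h ^+ 3 / 12 = 0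
              <-> S = Spoo \/ S = Smoo) /\
   (Sp w @[w --> +oo] --> Spoo /\ Sp w @[w --> -oo] --> Spoo) /\
   (Sm w @[w --> +oo] --> Smoo /\ Sm w @[w --> -oo] --> Smoo) /\
   (* the labelling of the two roots depends on the sign of Q *)
   (Q <= 0 ->
      Spoo = rho / (kappa * G) /\ Smoo = rho * h ^+ 3 / (12 * D) /\
      asymptotic_slope wL slope1 /\ asymptotic_slope (- wL) (- slope1) /\
      asymptotic_slope wU slope2 /\ asymptotic_slope (- wU) (- slope2)) /\
   (0 <= Q ->
      Spoo = rho * h ^+ 3 / (12 * D) /\ Smoo = rho / (kappa * G) /\
      asymptotic_slope wL slope2 /\ asymptotic_slope (- wL) (- slope2) /\
      asymptotic_slope wU slope1 /\ asymptotic_slope (- wU) (- slope1)) /\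
   (* for D and G given by Young's modulus and Poisson's ratio, and
      kappa <= 1, the first case holds *)
   (forall E nu : R, 0 < E -> -1 < nu < 1 -> kappa <= 1 ->
      G = E / (2 * (1 + nu)) -> D = E * h ^+ 3 / (12 * (1 - nu ^+ 2)) ->
      Q < 0) /\
   (* the uncoupled straight lines, factor by factor *)
   (forall k w : R, rho * w ^+ 2 - kappa * G * k ^+ 2 = 0
                <-> w = slope1 * k \/ w = - (slope1 * k)) /\
   (forall k w : R, rho * h ^+ 3 / 12 * w ^+ 2 - D * k ^+ 2 = 0
                <-> w = slope2 * k \/ w = - (slope2 * k)) /\
   (forall k w : R, A0 k w = 0 <->
                [\/ w = slope1 * k, w = - (slope1 * k),
                    w = slope2 * k | w = - (slope2 * k)])).
Proof.
move=> A A0 P Q Rc Sp Sm Spoo Smoo lower upper c1 c2 c3 w0 d1 d2 slope1 slope2.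
pose a := rho ^+ 2 * h ^+ 3 / 12; pose c := kappa * G * D.
pose B := b ^+ 2 * kappa * G * rho * h.
have a0 : 0 < a by rewrite divr_gt0 // mulr_gt0 ?exprn_gt0.
have c0 : 0 < c by rewrite !mulr_gt0.
have B0 : 0 < B by rewrite !mulr_gt0 ?exprn_gt0.
have P0 : 0 < P by rewrite addr_gt0 ?divr_gt0 ?mulr_gt0 ?exprn_gt0.
have Pd : 4 * a * c <= P ^+ 2 by rewrite -subr_ge0 -coefQ_sqr sqr_ge0.
have c1_gt0 : 0 < c1 by rewrite divr_gt0 ?mulr_gt0 ?sqrtr_gt0 ?mulr_gt0.
split.
  split; first by move=> k w w_neq0; exact: dispersion_slowness.
  split.
    move=> w w_neq0; split; first exact: Sminus_lt_Splus.
    by move=> S; exact: slowness_roots.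
  by split; [exact: Splus_series|exact: Sminus_series].
exists (low_branch R a c P B), (up_branch R a c P B).
split.
  split; first exact: low_branch_continuous.
  split; first exact: up_branch_continuous.
  split; first by move=> k; exact: low_branch_ge0.
  split; first by move=> k; exact: low_branch_lt_up_branch.
  split; first by move=> k w; exact: on_lowerP.
  split; first by move=> k w; exact: on_upperP.
  by move=> k w; rewrite /A dispersionE; exact: curve_branchP.
split.
  split; first by near=> w; exact: Splus_gt0.
  split; first exact: Splus_sqr_equiv.
  split; first exact: Splus_sqr_cvg0.
  split; first exact: low_branch0.
  split; first exact: is_derive_low_branch0.
  split; first exact: c1_gt0.
  split; last exact: low_branch_series.
  (* Both numbers are nonnegative with square c/B. *)
  have -> : c1 = low_curvature R a c P B 0; last exact: low_branch_cvg_sqr.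
  apply/eqP; rewrite -(@eqrXn2 _ 2) ?sqrtr_ge0 ?(ltW c1_gt0) // low_curvature0 //.
  rewrite /c1 expr_div_n exprMn !sqr_sqrtr ?mulr_ge0 ?(ltW hD) ?(ltW hrho) ?(ltW hh) //.
  by apply/eqP; rewrite /c /B; field; rewrite !gt_eqF.
split.
  split; first exact: near_Sminus_lt0.
  split; first by move=> w; exact: ex_on_upper.
  by split; [exact: threshold_sqr|exact: up_branch_series].
split; first by split; [exact: cvg_div_sqr_pinfty|exact: cvg_div_sqr_ninfty].
split; first by move=> k w w_neq0; exact: uncoupled_dispersion.
split; first by move=> S; exact: slowness_infty_roots.
split; first exact: Splus_cvg_infty.
split; first exact: Sminus_cvg_infty.
split.
  move=> Q0; have [pE mE] : Spoo = rho / (kappa * G) /\ Smoo = rho * h ^+ 3 / (12 * D).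
    exact: slowness_infty_le0.
  have [sL sU] : asymptotic_slope (low_branch R a c P B) slope1 /\
      asymptotic_slope (up_branch R a c P B) slope2 by exact: branch_slopes_le0.
  have [sLN sUN] := (asymptotic_slopeN _ _ _ sL, asymptotic_slopeN _ _ _ sU).
  exact: (conj pE (conj mE (conj sL (conj sLN (conj sU sUN))))).
split.
  move=> Q0; have [pE mE] : Spoo = rho * h ^+ 3 / (12 * D) /\ Smoo = rho / (kappa * G).
    exact: slowness_infty_ge0.
  have [sL sU] : asymptotic_slope (low_branch R a c P B) slope2 /\
      asymptotic_slope (up_branch R a c P B) slope1 by exact: branch_slopes_ge0.
  have [sLN sUN] := (asymptotic_slopeN _ _ _ sL, asymptotic_slopeN _ _ _ sU).
  exact: (conj pE (conj mE (conj sL (conj sLN (conj sU sUN))))).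
split; first by move=> E nu E0 nu1 k1 GE DE; apply: coefQ_lt0 GE DE.
split; first by move=> k w; exact: shear_line.
split; first by move=> k w; exact: bending_line.
by move=> k w; exact: uncoupled_lines.
Unshelve. all: by end_near. Qed.
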